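(* Let $\delta>0$. Let $R$ be a positive random variable whose density has bounded support, and let $Y$ be a positive bounded random variable, independent of $R$, such that $$RY\stackrel{d}{=}U^{1/\delta}\stackrel{d}{=}\beta_{\delta,1}$$ (if $R\stackrel{d}{=}cU^{1/\delta}$ for a constant $c>0$, then $Y=1/c$). Let $\zeta^{(\delta)}$ be a subordinator with $$\psi_{\zeta^{(\delta)}}(\omega)=\mathbb{E}[\psi_Z(\omega U^{1/\delta})],$$ where $Z$ is a subordinator (the $\mathcal U_\delta$-BDLP of $\zeta^{(\delta)}$), so that $\psi_Z(\omega)=\psi_{\zeta^{(\delta)}}(\omega)+\frac1\delta\omega\psi'_{\zeta^{(\delta)}}(\omega)$ and $\zeta^{(\delta)}\in\mathcal U_\delta$. Let $L$ be the subordinator chosen such that $$\psi_L(\omega)=\mathbb{E}[\psi_Z(\omega Y)],\qquad\text{equivalently}\qquad \rho_L(x)=\mathbb{E}[\rho_Z(x/Y)Y^{-1}],$$ that is, $$\psi_L(\omega)=\mathbb{E}\big[\psi_{\zeta^{(\delta)}}(\omega Y)\big]+\frac1\delta\,\omega\,\mathbb{E}\big[Y\psi'_{\zeta^{(\delta)}}(\omega Y)\big],$$ where $Y$ is independent of $R$ and $Z$. Then the quantile clock $T_R(t)=\int_0^tQ_R((1-s/t)_+)L(ds)$ with parameters $(R,L)$ satisfies $$T_R(t)\stackrel{d}{=}\zeta^{(\delta)}(t)\qquad\text{for each fixed }t .$$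
   Context: A subordinator $\zeta$ is an increasing right-continuous process started at $0$ with stationary independent increments, with zero drift; $\mathbb{E}[e^{-\omega\zeta(t)}]=e^{-t\psi_\zeta(\omega)}$ with Laplace exponent $\psi_\zeta(\omega)=\int_0^\infty(1-e^{-\omega s})\Lambda_\zeta(ds)$, $\omega>0$; $\Lambda_\zeta$ is the Lévy measure and $\rho_\zeta(s)=\Lambda_\zeta(ds)/ds$ the Lévy density (when it exists). The driving subordinator $L$ of a quantile clock is of infinite activity (infinite total Lévy mass). $U$ is uniform on $[0,1]$ and $\beta_{a,b}$ a beta$(a,b)$ variable. Quantile clock: $R$ is a positive random variable with continuous, strictly increasing (on its support) cumulative distribution function $F_R$, and $\mathbb{E}[R]<\infty$; $Q_R(u)=\inf\{t:F_R(t)\ge u\}$ is its quantile function; $(a)_+=\max(0,a)$. Class $\mathcal U_\delta$ ($\delta>0$; Jurek's generalized $s$-selfdecomposable laws on $\mathbb R_+$): a subordinator $\zeta^{(\delta)}$ is in $\mathcal U_\delta$ if there is a subordinator $Z$, called its $\mathcal U_\delta$-BDLP, with $\psi_{\zeta^{(\delta)}}(\omega)=\int_0^1\psi_Z(\omega u^{1/\delta})\,du$ (i.e. $\zeta^{(\delta)}(t)\stackrel{d}{=}\int_0^1u^{1/\delta}Z(t\,du)$). *)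

(* Defs.v *)
From HB Require Import structures.
From mathcomp Require Import all_boot all_order all_algebra.
From mathcomp Require Import all_classical all_reals all_analysis.
From mathcomp Require Import measurable_realfun.

Set Implicit Arguments.
Unset Strict Implicit.
Unset Printing Implicit Defensive.

Import Order.TTheory GRing.Theory Num.Theory.
Import numFieldNormedType.Exports.

Local Open Scope classical_set_scope.
Local Open Scope ring_scope.

(* Measurability is part of the definition because a measure of the library is
   a function on all sets and is only meaningful on measurable ones. *)
Definition eq_law (K : realType)
    (d1 : measure_display) (T1 : measurableType d1) (P1 : probability T1 K)
    (d2 : measure_display) (T2 : measurableType d2) (P2 : probability T2 K)
    (d : measure_display) (S : measurableType d)
    (X1 : T1 -> S) (X2 : T2 -> S) : Prop :=
  [/\ measurable_fun setT X1, measurable_fun setT X2 &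
      forall A, measurable A -> P1 (X1 @^-1` A) = P2 (X2 @^-1` A)].

Definition independent_rv (K : realType)
    (d : measure_display) (T : measurableType d) (P : probability T K)
    (X Y : {RV P >-> K}) : Prop :=
  forall A B : set K, measurable A -> measurable B ->
    P (X @^-1` A `&` Y @^-1` B) = (P (X @^-1` A) * P (Y @^-1` B))%E.

(* The cylinder events form a pi-system generating the sigma-algebra of the
   family [Z t], [0 <= t], so this is independence of [X] and that
   sigma-algebra. *)
Definition independent_of_process (K : realType)
    (d : measure_display) (T : measurableType d) (P : probability T K)
    (X : {RV P >-> K}) (Z : K -> {RV P >-> K}) : Prop :=
  forall (n : nat) (t : nat -> K) (A : set K) (B : nat -> set K),
    (forall i, 0 <= t i) -> measurable A -> (forall i, measurable (B i)) ->
    let C := \bigcap_(i < n) (Z (t i) @^-1` B i) in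
    P (X @^-1` A `&` C) = (P (X @^-1` A) * P C)%E.

Definition has_density (K : realType)
    (d : measure_display) (T : measurableType d) (P : probability T K)
    (X : T -> K) (f : K -> K) : Prop :=
  [/\ measurable_fun setT X, measurable_fun setT f, forall x, 0 <= f x &
      forall A : set K, measurable A ->
        P (X @^-1` A) = (\int[lebesgue_measure]_(x in A) (f x)%:E)%E].

(* The beta function and beta law of the library only take natural-number
   parameters. *)
Definition beta_function (K : realType) (a b : K) : K :=
  \int[lebesgue_measure]_(x in `]0, 1[) (x `^ (a - 1) * (1 - x) `^ (b - 1)).

Definition beta_density (K : realType) (a b : K) (x : K) : K :=
  if 0 < x < 1 then x `^ (a - 1) * (1 - x) `^ (b - 1) / beta_function a b
  else 0.

Definition laplace_exponent_of (K : realType)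
    (Lambda : {measure set K -> \bar K}) (omega : K) : K :=
  \int[Lambda]_(s in `]0, +oo[) (1 - expR (- (omega * s))).

(* Processes are indexed by [K]; only the times [0 <= t] matter.  The absence
   of drift is the absence of a linear term in [sub_laplace]. *)
Record subordinator (K : realType)
    (d : measure_display) (T : measurableType d) (P : probability T K) :=
  Subordinator {
  sub_process :> K -> {RV P >-> K} ;
  levy : {measure set K -> \bar K} ;
  sub_start0 : forall w, sub_process 0 w = 0 ;
  sub_increasing : forall w (s t : K), 0 <= s -> s <= t ->
    sub_process s w <= sub_process t w ;
  sub_right_continuous : forall w (t : K), 0 <= t ->
    sub_process s w @[s --> t^'+] --> sub_process t w ;
  sub_stationary : forall s t : K, 0 <= s -> 0 <= t ->
    eq_law P P (fun w => sub_process (s + t) w - sub_process s w)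
               (sub_process t) ;
  sub_independent : forall (n : nat) (t : nat -> K) (B : nat -> set K),
    0 <= t 0%N -> (forall i, t i <= t i.+1) -> (forall i, measurable (B i)) ->
    let incr i w := sub_process (t i.+1) w - sub_process (t i) w in
    P (\bigcap_(i < n) (incr i @^-1` B i)) =
      (\prod_(i < n) P (incr i @^-1` B i))%E ;
  levy_nonpos : levy `]-oo, 0]%classic = 0%E ;
  levy_integrable :
    (\int[levy]_(s in `]0%R, +oo[) (Num.min 1 s)%:E < +oo)%E ;
  sub_laplace : forall t omega : K, 0 <= t -> 0 < omega ->
    'E_P[fun w => expR (- (omega * sub_process t w))]%E =
      (expR (- (t * laplace_exponent_of levy omega)))%:E }.

Definition laplace_exponent (K : realType)
    (d : measure_display) (T : measurableType d) (P : probability T K)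
    (zeta : subordinator P) : K -> K :=
  laplace_exponent_of (levy zeta).

Definition infinite_activity (K : realType)
    (d : measure_display) (T : measurableType d) (P : probability T K)
    (zeta : subordinator P) : Prop :=
  levy zeta `]0, +oo[%classic = +oo%E.

Definition levy_density (K : realType)
    (d : measure_display) (T : measurableType d) (P : probability T K)
    (zeta : subordinator P) (rho : K -> \bar K) : Prop :=
  [/\ measurable_fun (`]0, +oo[ : set K) rho,
      forall x, 0 < x -> (0 <= rho x)%E &
      forall A : set K, measurable A -> A `<=` `]0, +oo[ ->
        levy zeta A = (\int[lebesgue_measure]_(x in A) rho x)%E].

Definition is_BDLP (K : realType) (delta : K)
    (d1 : measure_display) (T1 : measurableType d1) (P1 : probability T1 K)
    (d2 : measure_display) (T2 : measurableType d2) (P2 : probability T2 K)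
    (zeta : subordinator P1) (Z : subordinator P2) : Prop :=
  forall omega : K, 0 < omega ->
    (laplace_exponent zeta omega)%:E =
    (\int[lebesgue_measure]_(u in `[0%R, 1%R])
       (laplace_exponent Z (omega * u `^ delta^-1))%:E)%E.

Definition in_class_U (K : realType) (delta : K)
    (d : measure_display) (T : measurableType d) (P : probability T K)
    (zeta : subordinator P) : Prop :=
  exists (d' : measure_display) (T' : measurableType d')
         (P' : probability T' K) (Z : subordinator P'), is_BDLP delta zeta Z.

Definition law_support (K : realType)
    (d : measure_display) (T : measurableType d) (P : probability T K)
    (X : {RV P >-> K}) : set K :=
  [set x | forall e : K, 0 < e -> (0 < P (X @^-1` ball x e))%E].

Record clock_variable (K : realType)
    (d : measure_display) (T : measurableType d) (P : probability T K)
    (X : {RV P >-> K}) : Prop := ClockVariable {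
  clock_pos : forall w, 0 < X w ;
  clock_cdf_continuous : continuous (fun x => fine (cdf X x)) ;
  clock_cdf_increasing : forall x y, law_support X x -> law_support X y ->
    x < y -> (cdf X x < cdf X y)%E ;
  clock_finite_mean : P.-integrable setT (EFin \o X) }.

(* The infimum is over the half-line [0 <= x] where a positive variable lives,
   so that the value at [u = 0] is [0] rather than the infimum of the whole
   line; nothing changes for [0 < u]. *)
Definition quantile (K : realType)
    (d : measure_display) (T : measurableType d) (P : probability T K)
    (X : {RV P >-> K}) (u : K) : K :=
  inf [set x : K | 0 <= x /\ (u%:E <= cdf X x)%E].

Section sub_path.
Context (K : realType) (d : measure_display) (T : measurableType d)
  (P : probability T K) (L : subordinator P) (w : T).

Definition sub_path (s : K) : K := L (Num.max 0 s) w.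

Let spath_nd : nondecreasing sub_path.
Proof.
move=> s t st; apply: sub_increasing; first by rewrite le_max lexx.
by rewrite ge_max !le_max lexx/= st orbT.
Qed.

Let spath_rc : right_continuous sub_path.
Proof.
move=> t; rewrite /sub_path; have [t0|t0] := ltP t 0.
  apply: (@cvg_trans _ (cst (L 0 w) @ t^'+)).
    apply: near_eq_cvg; near=> s; rewrite /cst/= max_l//.
    by near: s; apply: nbhs_right_le.
  exact: cvg_cst.
apply: cvg_trans (@sub_right_continuous _ _ _ _ L w _ t0).
apply: near_eq_cvg; near=> s; rewrite max_r//.
by rewrite (le_trans t0)// ltW//; near: s; apply: nbhs_right_gt.
Unshelve. all: by end_near. Qed.

HB.instance Definition _ := isCumulative.Build K _ K sub_path spath_nd spath_rc.

End sub_path.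

(* Pathwise Lebesgue-Stieltjes integral; no mass is lost by leaving out [0],
   since [L 0 = 0]. *)
Definition quantile_clock (K : realType)
    (d1 : measure_display) (T1 : measurableType d1) (P1 : probability T1 K)
    (d2 : measure_display) (T2 : measurableType d2) (P2 : probability T2 K)
    (X : {RV P1 >-> K}) (L : subordinator P2) (t : K) (w : T2) : \bar K :=
  (\int[lebesgue_stieltjes_measure (sub_path L w)]_(s in `]0%R, t])
     (quantile X (Num.max 0 (1 - s / t)))%:E)%E.

(* Main.v *)
From HB Require Import structures.
From mathcomp Require Import all_boot all_order all_algebra.
From mathcomp Require Import all_classical all_reals all_analysis.
From mathcomp Require Import measurable_realfun.
From mathcomp Require Import unstable ring lra.
Require Import Defs.

Import Order.TTheory GRing.Theory Num.Theory.
Import numFieldNormedType.Exports.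

Local Open Scope classical_set_scope.
Local Open Scope ring_scope.

Set Implicit Arguments.
Unset Strict Implicit.
Unset Printing Implicit Defensive.

(** The clock is an integral of a deterministic kernel against [L], so its Laplace
   exponent is that of [L] averaged along the kernel:
     [- ln E e^(- w T_R(t)) = int_0^t psi_L (w Q_R (1 - s/t)) ds].
   The substitution [u = 1 - s/t] makes this [t E psi_L (w R)], since [Q_R] carries
   the uniform law to the law of [R].  As [psi_L] is the mixture of [psi_Z] over
   [Y], which is independent of [R], this is [t E psi_Z (w R Y)], and
   [R Y ~ U^(1/delta)] turns it into [t psi_zeta w].  So [T_R(t)] and [zeta(t)]
   have the same Laplace transform, hence the same law.  The computation of the
   mean is [mixed_exponent], that of the transform of the clock is
   [quantile_clock_laplace], and the conclusion is [quantile_clock_law].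

   The transform of the clock comes from step functions.  Replacing the argument
   of the kernel by the right end of its cell gives a finite sum of increments of
   [L], whose transform is a product by [independent_prod].  The kernel is right
   continuous, because [Q_R] is left continuous, and it is bounded, because [R]
   has bounded support; so dominated convergence applies along each path of [L]
   as well as under Lebesgue measure.

   Everything that goes back from exponents to measures rests on
   [laplace_exponent_unique]: the integrals of [1 - e^(-ws)] for all [w > 0]
   determine a measure on the open half-line, even one of infinite mass.  The
   mass of a ray is the limit of the integrals of explicit combinations of these
   functions, namely [(1 - x^(n+1))^N] with [x = e^(-ws)] and
   [N = (n+1) 2^(n+1)], which converge to the indicator of [x < 1/2] and stay
   below [2 (1 - x)].  Applied to laws it gives [laplace_law]; applied to Levy
   measures it shows that the mixture of exponents and the mixture of densities
   are the same prescription of [L] ([mixture_levy_density]).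

   The substitution [s = w^delta u] in the mixture over [U^(1/delta)] gives
   [w^delta psi_zeta w = int_0^(w^delta) psi_Z (s^(1/delta)) ds].  Differentiating
   expresses [psi_Z] by [psi_zeta] and its derivative ([power_mixture_derive]),
   and taking the expectation at [w Y] gives the third form of [psi_L].
   Finally, if [R] is distributed as [c U^(1/delta)], then comparing first and
   second moments in [R Y ~ U^(1/delta)] gives [E (c Y - 1)^2 = 0]
   ([scaled_uniform_power_cst]). *)

(** * Measures with a density, and measures on the line *)

(** A push-forward is a measure only because its function is measurable; that
   proof is an argument here, so that the measure can be written down. *)
Definition pushforward_measure (d1 d2 : measure_display)
    (T : measurableType d1) (S : measurableType d2) (K : realType)
    (mu : {measure set T -> \bar K}) (f : T -> S)
    (mf : measurable_fun setT f) : {measure set S -> \bar K} :=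
  measure_function_pushforward__canonical__measure_function_Measure mu mf.

Section density_measure.
Local Open Scope ereal_scope.
Context d (T : measurableType d) (K : realType).
Variables (mu : {measure set T -> \bar K}) (h : T -> \bar K).
Hypotheses (mh : measurable_fun setT h) (h0 : forall x, 0 <= h x).

(** The two proofs are arguments because a measure structure is attached to this
   set function, and it exists only under these assumptions. *)
Definition density_measure of measurable_fun setT h & (forall x, 0 <= h x) :
  set T -> \bar K := fun A => \int[mu]_(x in A) h x.

Local Notation nu := (density_measure mh h0).

Let density_measure0 : nu set0 = 0.
Proof. exact: integral_set0. Qed.

Let density_measure_ge0 A : 0 <= nu A.
Proof. by apply: integral_ge0 => x _. Qed.

Let density_measure_additive : semi_sigma_additive nu.
Proof.
move=> F mF tF mUF; rewrite /density_measure; apply: cvg_toP.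
  apply: ereal_nondecreasing_is_cvgn => m n mn.
  by apply: lee_sum_nneg_natr => // k _ _; exact: integral_ge0.
by rewrite ge0_integral_bigcup//=; exact: measurable_funTS.
Qed.

HB.instance Definition _ := isMeasure.Build _ _ _ nu
  density_measure0 density_measure_ge0 density_measure_additive.

Import HBNNSimple.

(** By definition for indicators, by linearity for simple functions, and by
   monotone convergence in general. *)
Lemma ge0_integral_density (g : T -> \bar K) :
  measurable_fun setT g -> (forall x, 0 <= g x) ->
  \int[nu]_x g x = \int[mu]_x (g x * h x).
Proof.
move=> mg g0; pose g_ := nnsfun_approx measurableT mg.
have gcvg x : EFin \o g_^~ x @ \oo --> g x by exact: cvg_nnsfun_approx.
have gnd x : {homo (fun n => (g_ n x)%:E) : m n / (m <= n)%N >-> m <= n}.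
  by move=> m n mn; rewrite lee_fin; exact/lefP/nd_nnsfun_approx.
have step n : \int[nu]_x (g_ n x)%:E = \int[mu]_x ((g_ n x)%:E * h x).
  under [LHS]eq_integral do rewrite fimfunE -fsumEFin//.
  rewrite ge0_integral_fsum//; last 2 first.
  - by move=> r; exact/measurable_EFinP/measurable_funM.
  - by move=> r x _; rewrite nnfun_muleindic_ge0.
  transitivity (\sum_(r \in range (g_ n)) \int[mu]_x
      ((r * \1_(g_ n @^-1` [set r]) x)%:E * h x)).
    apply: eq_fsbigr => r _; rewrite integralZl_indic_nnsfun// integral_indic//=.
    rewrite setIT /density_measure.
    have [rneg|r0] := ltP r 0%R.
      rewrite preimage_nnfun0// integral_set0 mule0 -(mule0 0).
      by under eq_integral do rewrite indic0 mulr0 mul0e; rewrite integral0 mule0.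
    rewrite integral_mkcond -ge0_integralZl//=.
    - apply: eq_integral => x _; rewrite EFinM -muleA; congr (_ * _).
      by rewrite patchE indicE; case: ifPn => _; rewrite ?mul1e ?mul0e.
    - apply/(measurable_restrictT _ _).1 => //; exact: measurable_funTS.
    - by move=> x _; rewrite patchE; case: ifPn.
  rewrite -ge0_integral_fsum//.
  - apply: eq_integral => x _; rewrite [in RHS]fimfunE -fsumEFin// ge0_mule_fsuml//.
    by move=> r; rewrite nnfun_muleindic_ge0.
  - move=> r; apply: emeasurable_funM => //.
    exact/measurable_EFinP/measurable_funM.
  - by move=> r x _; rewrite mule_ge0// nnfun_muleindic_ge0.
transitivity (limn (fun n => \int[nu]_x (g_ n x)%:E)).
  rewrite -monotone_convergence//.
  - by apply: eq_integral => x _; apply/esym/cvg_lim => //; exact: gcvg.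
  - by move=> n; exact/measurable_EFinP/measurable_funP.
  - by move=> n x _; rewrite lee_fin.
under eq_fun do rewrite step.
rewrite -monotone_convergence//.
- apply: eq_integral => x _; apply/cvg_lim => //.
  (* Products of extended reals are discontinuous at 0 * +oo, so the points where
     a factor vanishes are treated apart: there every
     product is 0. *)
  have [gx0|gx0] := eqVneq (g x) 0.
    have gn0 n : (g_ n x)%:E = 0.
      apply/eqP; rewrite eq_le; apply/andP; split; last by rewrite lee_fin.
      rewrite -gx0 -(cvg_lim (@ereal_hausdorff K) (gcvg x)).
      rewrite (cvg_lim (@ereal_hausdorff K) (ereal_nondecreasing_cvgn (gnd x))).
      by apply: ereal_sup_ubound; exists n.
    by rewrite gx0 mul0e; under eq_fun do rewrite gn0 mul0e; exact: cvg_cst.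
  have [->|hx0] := eqVneq (h x) 0.
    by rewrite mule0; under eq_fun do rewrite mule0; exact: cvg_cst.
  apply: cvgeM (gcvg x) (cvg_cst _).
  by rewrite mule_defE (negbTE gx0) (negbTE hx0).
- move=> n; apply: emeasurable_funM => //.
  exact/measurable_EFinP/measurable_funP.
- by move=> n x _; rewrite mule_ge0// lee_fin.
- by move=> x _ m n mn; rewrite lee_wpmul2r//; exact: gnd.
Qed.

End density_measure.

Section integral_of_density.
Local Open Scope ereal_scope.
Context d1 d2 (T : measurableType d1) (S : measurableType d2) (K : realType).
Variables (mu : {measure set T -> \bar K}) (nu : {measure set S -> \bar K}).

(** The hypothesis says that [nu] is the measure of density [h] carried forward by
   [X].  With [h] a product of other variables this extends one factor of a
   product from indicators to all functions. *)
Lemma ge0_integral_comp_density (X : T -> S) (h : T -> \bar K) :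
  measurable_fun setT X -> measurable_fun setT h -> (forall x, 0 <= h x) ->
  (forall B, measurable B -> \int[mu]_(x in X @^-1` B) h x = nu B) ->
  forall g : S -> \bar K, measurable_fun setT g -> (forall y, 0 <= g y) ->
  \int[nu]_y g y = \int[mu]_x (g (X x) * h x).
Proof.
move=> mX mh h0 hnu g mg g0.
transitivity (\int[pushforward_measure (density_measure mu mh h0) mX]_y g y).
  by apply: eq_measure_integral => B mB _; rewrite /= /pushforward -hnu.
rewrite ge0_integral_pushforward// preimage_setT ge0_integral_density//.
- exact: measurableT_comp.
- by move=> x; exact: g0.
Qed.

End integral_of_density.

(** The measures may have infinite mass near 0, as Levy measures do.  Cut at
   [1/(n+1)] they are finite and the rays form a generating pi-system; the cut
   measures increase to the whole. *)
Lemma eq_measure_rays (K : realType) (m1 m2 : {measure set K -> \bar K}) :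
  (forall c : K, 0 < c -> m1 `]c, +oo[%classic = m2 `]c, +oo[%classic) ->
  (forall c : K, 0 < c -> (m1 `]c, +oo[%classic < +oo)%E) ->
  forall A : set K, measurable A -> A `<=` `]0, +oo[ -> m1 A = m2 A.
Proof.
move=> m12 m1oo A mA A0.
pose D n : set K := `]n.+1%:R^-1, +oo[%classic.
have mD n : measurable (D n) by exact: measurable_itv.
have D12 n B : measurable B -> m1 (B `&` D n) = m2 (B `&` D n).
  move=> mB; rewrite -[LHS]/(mrestr m1 (mD n) B) -[RHS]/(mrestr m2 (mD n) B).
  have rayI c : `]c, +oo[%classic `&` D n =
      `]Num.max c n.+1%:R^-1, +oo[%classic.
    rewrite /D; apply/seteqP; split=> x /=; rewrite !in_itv/= !andbT gt_max; last by move/andP.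
    by move=> [-> ->].
  have pos c : 0 < Num.max c (n.+1%:R^-1 : K) by rewrite lt_max invr_gt0 ltr0n orbT.
  apply: (measure_unique (RGenOInfty.G (R := K)) (fun k => `](- k%:R), +oo[%classic)) => //.
  - exact: RGenOInfty.measurableE.
  - move=> _ _ [x ->] [y ->]; exists (Num.max x y).
    apply/seteqP; split=> z /=; rewrite !in_itv/= !andbT gt_max; last by move/andP.
    by move=> [-> ->].
  - by move=> i; exists (- i%:R).
  - rewrite -subTset => x _; exists (Num.bound x) => //=.
    by rewrite in_itv/= andbT ltrNl ltrNbound.
  - by move=> _ [x ->]; rewrite /= /mrestr rayI m12.
  - by move=> k; rewrite /= /mrestr rayI m1oo.
have AD : A = \bigcup_n (A `&` D n).
  rewrite -setI_bigcupr; apply/esym/setIidl => x /A0/=; rewrite in_itv/= andbT => x0.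
  exists (Num.bound x^-1) => //; rewrite /D/= in_itv/= andbT invf_plt ?posrE ?ltr0n//.
  by rewrite (lt_trans (archi_boundP _)) ?invr_ge0 ?(ltW x0)// ltr_nat.
have ndD : {homo (fun n => A `&` D n) : m n / (m <= n)%N >-> m `<=` n}.
  move=> m n mn; apply: setIS => x; rewrite /D/= !in_itv/= !andbT; apply: le_lt_trans.
  by rewrite lef_pV2 ?posrE ?ltr0n// ler_nat ltnS.
have cvgA (m : {measure set K -> \bar K}) : m (A `&` D n) @[n --> \oo] --> m A.
  rewrite {2}AD; apply: nondecreasing_cvg_mu.
  - by move=> n; apply: measurableI.
  - by apply: bigcupT_measurable => n; apply: measurableI.
  - by move=> m' n mn; apply/subsetPset/ndD.
rewrite -(cvg_lim _ (cvgA m1))// -(cvg_lim _ (cvgA m2))//.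
by apply: congr_lim; apply/funext => n; exact: D12.
Qed.

(** Lebesgue measure lives on a copy of the line whose display differs from the
   default one; this brings measures back to the line itself. *)
Definition borel_measure (K : realType)
    (m : {measure set (measurableTypeR K) -> \bar K}) : {measure set K -> \bar K} :=
  pushforward_measure m
    (@measurable_id _ K setT : measurable_fun setT (id : measurableTypeR K -> K)).

Lemma ge0_integral_borel (K : realType)
    (m : {measure set (measurableTypeR K) -> \bar K}) (D : set K) (f : K -> \bar K) :
  measurable D -> measurable_fun D f -> (forall x, D x -> (0 <= f x)%E) ->
  (\int[borel_measure m]_(x in D) f x = \int[m]_(x in D) f x)%E.
Proof.
move=> mD mf f0.
have mid : measurable_fun setT (id : measurableTypeR K -> K) by exact: measurable_id.
by rewrite (ge0_integral_pushforward mid)// => x; rewrite inE; exact: f0.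
Qed.

Section lebesgue_scaling.
Context (K : realType).
Local Notation lambda := (@lebesgue_measure K).

Lemma lebesgue_measure_scale (c : K) (A : set K) : 0 < c -> measurable A ->
  lambda ( *%R c @^-1` A) = (c^-1%:E * lambda A)%E.
Proof.
move=> c0 mA.
have mc : measurable_fun [set: measurableTypeR K]
    ( *%R c : _ -> measurableTypeR K) by exact: mulrl_measurable.
pose nu : {measure set (measurableTypeR K) -> \bar K} :=
  mscale (NngNum (ltW c0)) (pushforward_measure lambda mc).
suff -> : lambda A = nu A.
  rewrite /nu/= /mscale/= /pushforward muleA -EFinM mulVf ?mul1e// gt_eqF//.
apply: (lebesgue_measure_unique (mu := nu)) => //= _ [[a b]] _ <-.
rewrite /mscale/= /pushforward.
have -> : *%R c @^-1` `]a, b] = `]c^-1 * a, c^-1 * b]%classic.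
  apply/seteqP; split=> x /=; rewrite !in_itv/= [c^-1 * _]mulrC [c^-1 * b]mulrC;
    by rewrite ltr_pdivrMr// ler_pdivlMr// [x * c]mulrC.
rewrite !lebesgue_measure_itv/= !lte_fin ltr_pM2l ?invr_gt0//; case: ifP => _.
  by rewrite -!EFinD -EFinM -mulrBr mulrA divff ?mul1r// gt_eqF.
by rewrite mule0.
Qed.

Lemma ge0_integral_scale (c : K) (D : set K) (f : K -> \bar K) : 0 < c ->
  measurable D -> measurable_fun D f -> (forall x, D x -> (0 <= f x)%E) ->
  (\int[lambda]_(x in *%R c @^-1` D) f (c * x)%R =
   c^-1%:E * \int[lambda]_(x in D) f x)%E.
Proof.
move=> c0 mD mf f0.
have mc : measurable_fun [set: measurableTypeR K]
    ( *%R c : _ -> measurableTypeR K) by exact: mulrl_measurable.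
transitivity (\int[pushforward lambda ( *%R c : _ -> measurableTypeR K)]_(x in D) f x)%E.
  rewrite ge0_integral_pushforward// => x; rewrite inE; exact: f0.
have ci : 0 <= c^-1 by rewrite invr_ge0 ltW.
rewrite -[RHS](@ge0_integral_mscale _ (measurableTypeR K) K lambda D mD (NngNum ci) f)//.
by apply: eq_measure_integral => A mA _; exact: lebesgue_measure_scale.
Qed.

End lebesgue_scaling.

(** * Laplace exponents determine the measure *)

Section laplace_test.
Context (K : realType).
Implicit Types x y r : K.

(** Bernoulli's inequality for [1 + y], and [(1 - y) (1 + y) <= 1]. *)
Lemma onemXn_le_inv y m : 0 <= y <= 1 -> (1 - y) ^+ m <= (1 + m%:R * y)^-1.
Proof.
move=> /andP[y0 y1]; have p1 : 0 < 1 + m%:R * y by rewrite ltr_pwDl// mulr_ge0.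
rewrite -[leRHS]mul1r ler_pdivlMr//.
have h : 1 + m%:R * y <= (1 + y) ^+ m.
  elim: m {p1} => [|m IH]; first by rewrite mul0r addr0 expr0.
  rewrite exprSr; apply: (le_trans _ (ler_wpM2r (addr_ge0 ler01 y0) IH)).
  rewrite -(natr1 m); have := ler0n K m; nra.
apply: (le_trans (ler_wpM2l _ h)); first by rewrite exprn_ge0// subr_ge0.
rewrite -exprMn; apply: exprn_ile1; nra.
Qed.

Lemma onemXn_ge y m : 0 <= y <= 1 -> 1 - m%:R * y <= (1 - y) ^+ m.
Proof.
move=> /andP[y0 y1]; elim: m => [|m IH]; first by rewrite mul0r subr0 expr0.
have y1' : 0 <= 1 - y by rewrite subr_ge0.
rewrite exprSr; apply: (le_trans _ (ler_wpM2r y1' IH)).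
rewrite -(natr1 m); have := ler0n K m; nra.
Qed.

(** With [r = s^2], one factor [s^n] keeps [n s^n] bounded and the other one tends
   to 0. *)
Lemma cvg_natmul_geometric r : 0 <= r < 1 ->
  (n%:R * r ^+ n : K) @[n --> \oo] --> (0 : K).
Proof.
move=> /andP[r0 r1]; pose s := Num.sqrt r.
have s0 : 0 <= s by exact: sqrtr_ge0.
have rs : r = s * s by rewrite -expr2 sqr_sqrtr.
have s1 : s < 1 by rewrite -[ltRHS]sqrtr1 ltr_sqrt.
have bnd n : n%:R * s ^+ n <= (1 - s)^-1.
  have := @onemXn_le_inv (1 - s) n; rewrite subKr.
  have s1' : 0 < 1 - s by rewrite subr_gt0.
  have -> : 0 <= 1 - s <= 1 by rewrite ltW//= lerBlDr lerDl.
  move=> /(_ isT) h; apply: (le_trans (ler_wpM2l (ler0n _ n) h)).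
  rewrite ler_pdivrMr; last by rewrite ltr_pwDl// mulr_ge0// ltW.
  rewrite mulrDr mulr1 mulrCA mulVf ?mulr1 ?gt_eqF// lerDr invr_ge0 ltW//.
apply: (@squeeze_cvgr _ _ _ _ (fun=> 0) (geometric (1 - s)^-1 s)).
- apply: nearW => n; rewrite mulr_ge0 ?exprn_ge0//= rs exprMn mulrA ler_wpM2r//.
  exact: exprn_ge0.
- exact: cvg_cst.
- by apply: cvg_geometric; rewrite ger0_norm.
Qed.

(** The exponent [N = (n+1) 2^(n+1)] is chosen so that [N x^(n+1)] tends to 0 for
   [x < 1/2] and is at least [n+1] for [x >= 1/2]; hence the limit is an
   indicator.  As the function vanishes at [x = 1], it is a combination of
   the functions [1 - x^k], which at [x = e^(-ws)] are the integrands of a Laplace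
   exponent. *)
Definition laplace_test n x := (1 - x ^+ n.+1) ^+ (n.+1 * 2 ^ n.+1)%N.

Lemma laplace_test_ge0 n x : 0 <= x <= 1 -> 0 <= laplace_test n x.
Proof. by move=> /andP[x0 x1]; rewrite exprn_ge0// subr_ge0 exprn_ile1. Qed.

Let exp_half n x : 2^-1 <= x -> 1 <= 2 ^+ n * x ^+ n.
Proof. by move=> hx; rewrite -exprMn exprn_ege1// mulrC -ler_pdivrMr// mul1r. Qed.

(** A Levy measure integrates [1 - e^(-ws)] but no constant, so domination has to
   be by a multiple of [1 - x].  For [x >= 1/2], one factor is at most
   [(n+1) (1 - x)] and the product of the others at most [1/(n+1)]. *)
Lemma laplace_test_le n x : 0 <= x <= 1 -> laplace_test n x <= 2 * (1 - x).
Proof.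
move=> /andP[x0 x1]; have y0 : 0 <= x ^+ n.+1 by exact: exprn_ge0.
have y1 : x ^+ n.+1 <= 1 by exact: exprn_ile1.
have [xh|xh] := leP 2^-1 x; last first.
  apply: (@le_trans _ _ 1); last lra.
  by apply: exprn_ile1; rewrite ?subr_ge0// lerBlDr lerDl.
pose N := (n.+1 * 2 ^ n.+1)%N.
have N0 : (0 < N)%N by rewrite muln_gt0 expn_gt0.
rewrite /laplace_test -/N -(prednK N0) exprS.
have h1 : 1 - x ^+ n.+1 <= n.+1%:R * (1 - x).
  have := @onemXn_ge (1 - x) n.+1; rewrite subKr subr_ge0 x1 lerBlDr lerDl x0.
  by move=> /(_ isT); lra.
have h2 : (1 - x ^+ n.+1) ^+ N.-1 <= n.+1%:R^-1.
  apply: (le_trans (@onemXn_le_inv _ _ _)); first by rewrite y0.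
  rewrite lef_pV2 ?posrE ?ltr0n//; last by rewrite ltr_pwDl// mulr_ge0.
  have : n.+1%:R <= N%:R * x ^+ n.+1 :> K.
    by rewrite natrM natrX -mulrA ler_peMr// exp_half.
  by rewrite -{1}(prednK N0) -natr1; lra.
have := ler_pM _ _ h1 h2; rewrite subr_ge0 y1 exprn_ge0 ?subr_ge0// => /(_ isT isT) h.
apply: (le_trans h); rewrite mulrAC divff ?mul1r ?pnatr_eq0//; lra.
Qed.

Lemma laplace_test_cvg x : 0 <= x <= 1 ->
  laplace_test n x @[n --> \oo] --> ((x < 2^-1)%R%:R : K).
Proof.
move=> /andP[x0 x1]; have x01 : 0 <= x <= 1 by rewrite x0.
have y01 n : 0 <= x ^+ n.+1 <= 1 by rewrite exprn_ge0 ?exprn_ile1.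
have [xh|xh] := ltP x 2^-1.
  have r01 : 0 <= 2 * x < 1 by rewrite mulr_ge0//=; lra.
  have cv : (1 - n.+1%:R * (2 * x) ^+ n.+1 : K) @[n --> \oo] --> (1 : K).
    rewrite -[X in _ --> X]subr0; apply: cvgB; first exact: cvg_cst.
    have := cvg_natmul_geometric r01; rewrite -(cvg_shiftS); exact.
  apply: (@squeeze_cvgr _ _ _ _ (fun n => 1 - n.+1%:R * (2 * x) ^+ n.+1) (fun=> 1));
    [|exact: cv|exact: cvg_cst].
  apply: nearW => n; apply/andP; split.
    apply: le_trans (onemXn_ge _ (y01 n)).
    by rewrite natrM natrX exprMn mulrA.
  have /andP[a b] := y01 n.
  by apply: exprn_ile1; rewrite ?subr_ge0// lerBlDr lerDl.
apply: (@squeeze_cvgr _ _ _ _ (fun=> 0) (fun n => n.+1%:R^-1)).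
- apply: nearW => n; rewrite laplace_test_ge0//=.
  apply: (le_trans (onemXn_le_inv _ (y01 n))).
  have h : n.+1%:R <= (n.+1 * 2 ^ n.+1)%:R * x ^+ n.+1 :> K.
    by rewrite natrM natrX -mulrA ler_peMr// exp_half.
  rewrite lef_pV2 ?posrE ?ltr0n//; first by lra.
  by rewrite ltr_pwDl// mulr_ge0// exprn_ge0.
- exact: cvg_cst.
- exact: cvg_harmonic.
Qed.

End laplace_test.

Lemma measurable_onem_expR (K : realType) (w : K) (A : set K) :
  measurable_fun A (fun s : K => 1 - expR (- (w * s))).
Proof.
apply: measurable_funTS; apply: measurable_funB => //.
by apply: measurableT_comp => //; apply: measurableT_comp => //.
Qed.

Lemma onem_expR_ge0 (K : realType) (w s : K) : 0 <= w -> 0 <= s ->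
  0 <= 1 - expR (- (w * s)).
Proof. by move=> w0 s0; rewrite subr_ge0 -expR0 ler_expR oppr_le0 mulr_ge0. Qed.

Section laplace_uniqueness.
Context (K : realType) (m1 m2 : {measure set K -> \bar K}).
Local Notation D := (`]0, +oo[%classic : set K).

Let Dpos (s : K) : D s -> 0 < s.
Proof. by rewrite /= in_itv/= andbT. Qed.

Let agree (f : K -> K) : Prop :=
  [/\ m1.-integrable D (EFin \o f), m2.-integrable D (EFin \o f) &
      (\int[m1]_(s in D) (f s)%:E = \int[m2]_(s in D) (f s)%:E)%E].

Let agreeB f g : agree f -> agree g -> agree (fun s => f s - g s).
Proof.
move=> [f1 f2 f12] [g1 g2 g12]; split.
- by have := integrableB (measurable_itv _) f1 g1; apply: eq_integrable.
- by have := integrableB (measurable_itv _) f2 g2; apply: eq_integrable.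
- under eq_integral do rewrite EFinB.
  under [RHS]eq_integral do rewrite EFinB.
  by rewrite !integralB// f12 g12.
Qed.

Hypothesis laplace_eq : forall w : K, 0 < w ->
  (\int[m1]_(s in D) (1 - expR (- (w * s)))%:E =
   \int[m2]_(s in D) (1 - expR (- (w * s)))%:E)%E.
Hypothesis laplace_fin : forall w : K, 0 < w ->
  (\int[m1]_(s in D) (1 - expR (- (w * s)))%:E < +oo)%E.

Let agree_onem_expR (w : K) : 0 < w -> agree (fun s => 1 - expR (- (w * s))).
Proof.
move=> w0.
have abs (s : K) : D s -> (`|(1 - expR (- (w * s)))%:E| = (1 - expR (- (w * s)))%:E)%E.
  by move=> /Dpos s0; rewrite gee0_abs// lee_fin onem_expR_ge0// ltW.
split; last exact: laplace_eq.
- apply/integrableP; split; first by apply/measurable_EFinP; exact: measurable_onem_expR.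
  rewrite (eq_integral (fun s => (1 - expR (- (w * s)))%:E)) ?laplace_fin//.
  by move=> s /[!inE]; exact: abs.
- apply/integrableP; split; first by apply/measurable_EFinP; exact: measurable_onem_expR.
  rewrite (eq_integral (fun s => (1 - expR (- (w * s)))%:E)) -?laplace_eq ?laplace_fin//.
  by move=> s /[!inE]; exact: abs.
Qed.

(** Expanding one factor at a time, [e^(-as) (1 - e^(-bs))^(N+1)] is a
   difference of two functions of the same form, hence by induction a finite
   combination of the functions [1 - e^(-ws)]. *)
Let agree_power (a b : K) N : 0 < a -> 0 < b ->
  agree (fun s => expR (- (a * s)) * (1 - expR (- (b * s))) ^+ N.+1).
Proof.
move=> + b0; elim: N a => [|N IH] a a0.
  have := agreeB (agree_onem_expR (addr_gt0 a0 b0)) (agree_onem_expR a0).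
  congr agree; apply/funext => s.
  by rewrite expr1 mulrDl opprD expRD; ring.
have := agreeB (IH _ a0) (IH _ (addr_gt0 a0 b0)).
congr agree; apply/funext => s.
by rewrite [in RHS]exprSr mulrDl opprD expRD; ring.
Qed.

Let agree_power0 (b : K) N : 0 < b ->
  agree (fun s => (1 - expR (- (b * s))) ^+ N.+1).
Proof.
move=> b0; elim: N => [|N IH].
  by have := agree_onem_expR b0; congr agree; apply/funext => s; rewrite expr1.
have := agreeB IH (agree_power N b0 b0); congr agree; apply/funext => s.
by rewrite [in RHS]exprSr; ring.
Qed.

(** With [w = ln 2 / c], [e^(-ws) < 1/2] exactly when [s > c]: the test
   functions tend to the indicator of [s > c], dominated by
   [2 (1 - e^(-ws))]. *)
Let test_cvg (m : {measure set K -> \bar K}) (c : K) : 0 < c ->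
  (forall w : K, 0 < w -> m.-integrable D (fun s => (1 - expR (- (w * s)))%:E)) ->
  let w := ln 2 / c in
  ((\int[m]_(s in D) (laplace_test n (expR (- (w * s))))%:E)%E @[n --> \oo] -->
    m `]c, +oo[%classic) /\ (m `]c, +oo[%classic < +oo)%E.
Proof.
move=> c0 mi w.
have w0 : 0 < w by rewrite divr_gt0// ln_gt0// ltr1n.
have e01 (s : K) : D s -> 0 <= expR (- (w * s)) <= 1.
  move=> /Dpos s0; rewrite expR_ge0/= -expR0 ler_expR oppr_le0.
  by rewrite mulr_ge0// ltW.
have mtest n : measurable_fun D (fun s => laplace_test n (expR (- (w * s)))).
  apply: measurable_funTS; apply: measurable_funX; apply: measurable_funB => //.
  apply: measurable_funX.
  by apply: measurableT_comp => //; apply: measurableT_comp => //.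
have half (s : K) : (expR (- (w * s)) < 2^-1) = (c < s).
  rewrite -[2^-1]lnK ?posrE ?invr_gt0// ltr_expR lnV ?posrE// ltrN2.
  by rewrite /w mulrAC ltr_pdivlMr// ltr_pM2l// ln_gt0// ltr1n.
have mD : measurable (D : set K) by exact: measurable_itv.
have -> : m `]c, +oo[%classic = (\int[m]_(s in D) (\1_(`]c, +oo[%classic : set K) s)%:E)%E.
  rewrite integral_indic//; congr (m _); apply/esym/setIidl => s /=.
  by rewrite !in_itv/= !andbT; exact: lt_trans.
have [] := @dominated_convergence _ _ _ m D mD
  (fun n s => (laplace_test n (expR (- (w * s))))%:E)
  (fun s => (\1_(`]c, +oo[%classic : set K) s)%:E)
  (fun s => (2%:E * (1 - expR (- (w * s)))%:E)%E).
- by move=> n; exact/measurable_EFinP.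
- exact/measurable_EFinP.
- apply/aeW => s Ds; apply: cvg_EFin; first exact: nearW.
  have := laplace_test_cvg (e01 _ Ds); rewrite half indicE.
  by rewrite mem_setE/= in_itv/= andbT.
- exact/integrableZl/mi.
- apply/aeW => s n Ds; rewrite gee0_abs ?lee_fin ?laplace_test_ge0// ?e01//.
  by rewrite laplace_test_le// e01.
- move=> mi1 _ cv; split; first exact: cv.
  exact: integrable_lty mi1.
Qed.

(** The two measures give the same integral to each test function of a ray, hence
   the same mass to the ray. *)
Lemma laplace_exponent_unique (A : set K) : measurable A -> A `<=` D ->
  m1 A = m2 A.
Proof.
have pos (c : K) : 0 < c -> 0 < ln 2 / c :> K.
  by move=> c0; rewrite divr_gt0// ln_gt0// ltr1n.
have mi1 (w : K) : 0 < w -> m1.-integrable D (fun s => (1 - expR (- (w * s)))%:E).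
  by move=> /agree_onem_expR[].
have mi2 (w : K) : 0 < w -> m2.-integrable D (fun s => (1 - expR (- (w * s)))%:E).
  by move=> /agree_onem_expR[].
apply: eq_measure_rays => c c0; last exact: (test_cvg c0 mi1).2.
have [h1 _] := test_cvg c0 mi1; have [h2 _] := test_cvg c0 mi2.
apply: (cvg_unique _ h1); first exact: ereal_hausdorff.
apply: cvg_trans h2; apply: near_eq_cvg; apply: nearW => n.
pose N := (n.+1 * 2 ^ n.+1)%N.
have N0 : (0 < N)%N by rewrite muln_gt0 expn_gt0.
have [_ _] := @agree_power0 (n.+1%:R * (ln 2 / c)) N.-1 (mulr_gt0 (ltr0Sn _ _) (pos _ c0)).
rewrite (prednK N0) => e.
under eq_integral do rewrite /laplace_test -expRM_natl mulrN mulrA.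
by under [RHS]eq_integral do rewrite /laplace_test -expRM_natl mulrN mulrA.
Qed.

End laplace_uniqueness.

(** * The Laplace exponent as a function *)

Section laplace_exponent_theory.
Context (K : realType) (m : {measure set K -> \bar K}).
Local Notation D := (`]0, +oo[%classic : set K).
Hypothesis m_int : (\int[m]_(s in D) (Num.min 1 s)%:E < +oo)%E.
Implicit Types a b w x : K.
Local Notation psi := (laplace_exponent_of m).

Let mD : measurable (D : set K).
Proof. exact: measurable_itv. Qed.

Let Dpos (s : K) : D s -> 0 < s.
Proof. by rewrite /= in_itv/= andbT. Qed.

Lemma integrable_onem_expR w : 0 <= w ->
  m.-integrable D (fun s => (1 - expR (- (w * s)))%:E).
Proof.
move=> w0; apply: (@le_integrable _ _ _ m D mD _ (fun s => ((1 + w)%:E * (Num.min 1 s)%:E)%E)).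
- by apply/measurable_EFinP; exact: measurable_onem_expR.
- move=> s /Dpos s0; rewrite -EFinM !gee0_abs ?lee_fin; last 2 first.
  + by rewrite mulr_ge0 ?addr_ge0// le_min ler01 ltW.
  + by rewrite onem_expR_ge0// ltW.
  have h1 := expR_ge0 (- (w * s)); have h2 := expR_ge1Dx (- (w * s)).
  by case: (leP 1 s) => h; nra.
- apply: integrableZl => //.
  apply/integrableP; split.
    apply/measurable_EFinP; apply: measurable_funTS.
    exact: measurable_minr.
  apply: le_lt_trans m_int; apply: ge0_le_integral => //.
  + by apply: measurableT_comp => //; apply/measurable_EFinP/measurable_funTS/measurable_minr.
  + by apply/measurable_EFinP/measurable_funTS/measurable_minr.
  + by move=> s /Dpos s0; rewrite gee0_abs// lee_fin le_min ler01 ltW.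
Qed.

Lemma laplace_exponent_ofE w : 0 <= w ->
  (psi w)%:E = (\int[m]_(s in D) (1 - expR (- (w * s)))%:E)%E.
Proof.
move=> w0; rewrite /laplace_exponent_of /Rintegral fineK//.
exact: (integrable_fin_num mD (integrable_onem_expR w0)).
Qed.

Lemma laplace_exponent_of_ge0 w : 0 <= w -> 0 <= psi w.
Proof.
move=> w0; rewrite -lee_fin laplace_exponent_ofE//; apply: integral_ge0 => s /Dpos s0.
by rewrite lee_fin onem_expR_ge0// ltW.
Qed.

Lemma laplace_exponent_of0 : psi 0 = 0.
Proof.
apply: EFin_inj; rewrite laplace_exponent_ofE//.
by under eq_integral do rewrite mul0r oppr0 expR0 subrr; rewrite integral0.
Qed.

Lemma laplace_exponent_of_le a b : 0 <= a -> a <= b -> psi a <= psi b.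
Proof.
move=> a0 ab; have b0 := le_trans a0 ab.
rewrite -lee_fin !laplace_exponent_ofE//; apply: ge0_le_integral => //.
- by move=> s /Dpos s0; rewrite lee_fin onem_expR_ge0// ltW.
- by apply/measurable_EFinP; exact: measurable_onem_expR.
- by apply/measurable_EFinP; exact: measurable_onem_expR.
- move=> s /Dpos s0; rewrite lee_fin lerD2l lerN2 ler_expR lerN2.
  by rewrite ler_wpM2r// ltW.
Qed.

(** For [a <= b], [e^(-as) - e^(-bs) = e^(-as) (1 - e^(-(b-a)s))] is at most
   [1 - e^(-(b-a)s)]: the modulus of continuity of the exponent is the
   exponent itself. *)
Lemma laplace_exponent_of_subadd a b : 0 <= a -> a <= b ->
  psi b - psi a <= psi (b - a).
Proof.
move=> a0 ab; have b0 := le_trans a0 ab; have ba0 : 0 <= b - a by rewrite subr_ge0.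
rewrite lerBlDr -lee_fin EFinD !laplace_exponent_ofE// -ge0_integralD//.
- apply: ge0_le_integral => //.
  + by move=> s /Dpos s0; rewrite lee_fin onem_expR_ge0// ltW.
  + by apply/measurable_EFinP; exact: measurable_onem_expR.
  + by apply: emeasurable_funD; apply/measurable_EFinP; exact: measurable_onem_expR.
  + move=> s /Dpos s0; rewrite -EFinD lee_fin.
    have -> : expR (- (b * s)) = expR (- (a * s)) * expR (- ((b - a) * s)).
      by rewrite -expRD; congr expR; ring.
    have := onem_expR_ge0 a0 (ltW s0); have := onem_expR_ge0 ba0 (ltW s0).
    by move: (expR _) (expR _) => u v; nra.
- by move=> s /Dpos s0; rewrite lee_fin onem_expR_ge0// ltW.
- by apply/measurable_EFinP; exact: measurable_onem_expR.
- by move=> s /Dpos s0; rewrite lee_fin onem_expR_ge0// ltW.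
- by apply/measurable_EFinP; exact: measurable_onem_expR.
Qed.

(** Dominated convergence along [w = 1/(n+1)], with dominating function
   [1 - e^(-s)]. *)
Let laplace_exponent_of_small (e : K) : 0 < e -> exists2 h, 0 < h & psi h < e.
Proof.
move=> e0.
have cv0 (s : K) : (1 - expR (- (n.+1%:R^-1 * s)))%:E @[n --> \oo] --> 0%E.
  apply: cvg_EFin; first exact: nearW.
  rewrite -[X in _ --> X](subrr 1) -{4}(@expR0 K); apply: cvgB; first exact: cvg_cst.
  apply: continuous_cvg; first exact: continuous_expR.
  rewrite -[X in _ --> X]oppr0; apply: cvgN; rewrite -[X in _ --> X](mul0r s).
  by apply: cvgMr_tmp; exact: cvg_harmonic.
have [|||||_ _ cv] := @dominated_convergence _ _ _ m D mD
  (fun n s => (1 - expR (- (n.+1%:R^-1 * s)))%:E) (cst 0%E)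
  (fun s => (1 - expR (- (1 * s)))%:E).
- by move=> n; apply/measurable_EFinP; exact: measurable_onem_expR.
- exact: measurable_cst.
- by apply/aeW => s _; exact: cv0.
- exact: integrable_onem_expR.
- apply/aeW => s n /Dpos s0; rewrite gee0_abs ?lee_fin ?onem_expR_ge0 ?(ltW s0)//.
  by rewrite lerD2l lerN2 ler_expR lerN2 ler_pM2r// invf_le1// ler1n.
move: cv; rewrite integral0 => /fine_cvgP[_] /cvgrPdist_lt /(_ _ e0)[N _ /(_ _ (leqnn N))].
rewrite sub0r normrN => h; exists N.+1%:R^-1; rewrite ?invr_gt0//.
by apply: le_lt_trans h; exact: ler_norm.
Qed.

(** The exponent is meaningful for nonnegative arguments; its even extension is
   continuous on the whole line, which makes all compositions measurable. *)
Lemma continuous_laplace_exponent_of : continuous (fun x => psi `|x|).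
Proof.
have modulus x y : `|psi `|x| - psi `|y| | <= psi `|x - y|.
  wlog yx : x y / `|y| <= `|x| => [wl|].
    have [/wl//|/ltW/wl] := leP `|y| `|x|.
    by rewrite distrC [X in _ <= psi X]distrC.
  rewrite ger0_norm ?subr_ge0 ?laplace_exponent_of_le//.
  apply: (le_trans (laplace_exponent_of_subadd _ yx)) => //.
  by apply: laplace_exponent_of_le; rewrite ?subr_ge0// lerB_dist.
move=> x; apply/cvgrPdist_lt => e e0.
have [h h0 ph] := laplace_exponent_of_small e0.
near=> y.
have yx : `|x - y| < h by near: y; exists h => // z.
apply: (le_lt_trans (modulus x y)); apply: le_lt_trans ph.
exact: (laplace_exponent_of_le (normr_ge0 _) (ltW yx)).
Unshelve. all: by end_near. Qed.

Lemma measurable_laplace_exponent_of : measurable_fun setT (fun x => psi `|x|).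
Proof. by apply: continuous_measurable_fun; exact: continuous_laplace_exponent_of. Qed.

End laplace_exponent_theory.

(** * Powers of a uniform variable *)

Lemma continuous_powR_pos (K : realType) (a x : K) : 0 < x ->
  {for x, continuous (fun y : K => y `^ a)}.
Proof.
move=> x0; apply: differentiable_continuous; apply/derivable1_diffP.
by apply: derivable_powR; rewrite in_itv/= andbT.
Qed.

Section uniform_power.
Context (K : realType) (d : measure_display) (T : measurableType d)
  (P : probability T K) (U : {RV P >-> K}).
Hypothesis U_unif : forall A : set K, measurable A ->
  distribution P U A = uniform_prob (@ltr01 K) A.
Local Notation lambda := (@lebesgue_measure K).

Lemma ge0_integral_uniform_rv (f : K -> \bar K) :
  measurable_fun setT f -> (forall x, (0 <= f x)%E) ->
  (\int[P]_w f (U w) = \int[lambda]_(u in `[0%R, 1%R]) f u)%E.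
Proof.
move=> mf f0.
have mU : measurable_fun setT (U : T -> measurableTypeR K).
  by have h : measurable_fun setT (U : T -> K) by []; exact: h.
transitivity (\int[pushforward_measure P mU]_u f u)%E.
  by rewrite (@ge0_integral_pushforward _ _ T (measurableTypeR K) K U mU P setT f).
transitivity (\int[uniform_prob (@ltr01 K)]_u f u)%E.
  apply: eq_measure_integral => A mA _; exact: U_unif.
by rewrite integral_uniform// subr0 invr1 mul1e.
Qed.

Variable delta : K.
Hypothesis delta0 : 0 < delta.
Local Notation V := (fun w => U w `^ delta^-1).

Lemma measurable_uniform_power : measurable_fun setT V.
Proof. by apply: (measurableT_comp (measurable_powR _)). Qed.

Definition power_density (x : K) : K :=
  if 0 < x < 1 then delta * x `^ (delta - 1) else 0.

Lemma power_density_ge0 x : 0 <= power_density x.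
Proof.
by rewrite /power_density; case: ifPn => // _; rewrite mulr_ge0 ?powR_ge0// ltW.
Qed.

Lemma measurable_power_density : measurable_fun setT power_density.
Proof.
apply: measurable_fun_if => //.
- by apply: measurable_and => //; exact: measurable_fun_ltr.
- apply: measurable_funTS; apply: measurable_funM => //; exact: measurable_powR.
Qed.

Lemma integral_power_density_gt (c : K) : 0 < c -> c < 1 ->
  (\int[lambda]_(x in `]c, +oo[) (power_density x)%:E = (1 - c `^ delta)%:E)%E.
Proof.
move=> c0 c1.
transitivity (\int[lambda]_(x in `[c, 1%R]) (delta * x `^ (delta - 1))%:E)%E.
  transitivity (\int[lambda]_(x in `]c, 1%R[) (delta * x `^ (delta - 1))%:E)%E; last first.
    apply/esym/integral_itv_bndoo.
    by apply/measurable_EFinP; apply: measurable_funTS; apply: measurable_funM.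
  rewrite [LHS]integral_mkcond [RHS]integral_mkcond; apply: eq_integral => x _.
  rewrite !patchE !mem_setE/= !in_itv/= andbT /power_density.
  have [cx|//] := ltP c x; rewrite (lt_trans c0 cx)/=.
  by case: ifP.
rewrite (@continuous_FTC2 _ (fun x => delta * x `^ (delta - 1)) (fun x => x `^ delta))//.
- by rewrite powR1 EFinB.
- apply: continuous_in_subspaceT => x; rewrite inE/= in_itv/= => /andP[cx _].
  apply: cvgMl_tmp; apply: continuous_powR_pos; exact: lt_le_trans cx.
- split.
  + move=> x; rewrite in_itv/= => /andP[cx _]; apply: derivable_powR.
    by rewrite in_itv/= andbT (lt_trans c0).
  + by apply: cvg_at_right_filter; exact: continuous_powR_pos.
  + by apply: cvg_at_left_filter; exact: continuous_powR_pos.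
- move=> x; rewrite in_itv/= => /andP[cx _]; apply: powR_derive1.
  by rewrite in_itv/= andbT (lt_trans c0).
Qed.

Let powRK (c : K) : 0 <= c -> (c `^ delta) `^ delta^-1 = c.
Proof. by move=> c0; rewrite -powRrM divff ?gt_eqF// powRr1. Qed.

Let lt_root (c u : K) : 0 <= c -> 0 <= u -> (c < u `^ delta^-1) = (c `^ delta < u).
Proof.
move=> c0 u0; rewrite -[in LHS](powRK c0).
have di0 : 0 < delta^-1 by rewrite invr_gt0.
apply/idP/idP; last by apply: gt0_ltr_powR; rewrite ?nnegrE ?powR_ge0.
apply: contraTT; rewrite -!leNgt => h.
by apply: ge0_ler_powR; rewrite ?nnegrE ?powR_ge0// ltW.
Qed.

Let uniform_powerE (B : set K) : measurable B ->
  P (V @^-1` B) = lambda (`[0, 1] `&` [set u : K | B (u `^ delta^-1)]).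
Proof.
move=> mB.
have mR : measurable_fun setT (fun u : K => u `^ delta^-1) by exact: measurable_powR.
have mB' : measurable [set u : K | B (u `^ delta^-1)].
  by rewrite -[X in measurable X]setTI; exact: mR.
rewrite setIC -integral_indic//.
rewrite -(@ge0_integral_uniform_rv (fun u => (\1_[set u : K | B (u `^ delta^-1)] u)%:E))//.
- rewrite integral_indic ?setIT//.
  rewrite -[X in measurable X]setTI; exact: measurable_uniform_power.
- exact/measurable_EFinP.
Qed.

(** [U^(1/delta) > c] exactly when [U > c^delta]. *)
Let uniform_power_gt (c : K) : 0 < c ->
  P (V @^-1` `]c, +oo[) = (\int[lambda]_(x in `]c, +oo[) (power_density x)%:E)%E.
Proof.
move=> c0; rewrite uniform_powerE//.
have [c1|c1] := ltP c 1.
  rewrite integral_power_density_gt//.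
  rewrite (_ : _ `&` _ = `]c `^ delta, 1]%classic); last first.
    apply/seteqP; split=> u /=; rewrite !in_itv/= andbT.
      by move=> [/andP[u0 ->]]; rewrite lt_root ?(ltW c0)// => ->.
    move=> /andP[cu u1]; have u0 := le_trans (powR_ge0 _ _) (ltW cu).
    by rewrite u0 u1 lt_root ?(ltW c0).
  have cd1 : c `^ delta < 1.
    have <- : 1 `^ delta = 1 :> K by rewrite powR1.
    by rewrite gt0_ltr_powR ?nnegrE ?(ltW c0).
  by rewrite lebesgue_measure_itv/= lte_fin cd1.
rewrite (_ : _ `&` _ = set0) ?measure0.
  rewrite integral0_eq// => x; rewrite /= in_itv/= andbT => cx.
  by rewrite /power_density [x < 1]ltNge (ltW (le_lt_trans c1 cx)) andbF.
apply/seteqP; split => // u /=; rewrite !in_itv/= andbT => -[/andP[u0 u1]].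
apply/negP; rewrite -leNgt (le_trans _ c1)//.
have <- : 1 `^ delta^-1 = 1 :> K by rewrite powR1.
by rewrite ge0_ler_powR ?nnegrE// invr_ge0 ltW.
Qed.

(** Rays determine the law on the open half-line; 0 is the image of 0 alone, so it
   has no mass. *)
Lemma uniform_power_law (A : set K) : measurable A ->
  P (V @^-1` A) = (\int[lambda]_(x in A) (power_density x)%:E)%E.
Proof.
move=> mA.
have mpd : measurable_fun setT (EFin \o power_density).
  by apply/measurable_EFinP; exact: measurable_power_density.
have pd0 x : (0 <= (EFin \o power_density) x)%E by rewrite lee_fin power_density_ge0.
have mD : measurable (`]0, +oo[%classic : set K) by exact: measurable_itv.
have mV : measurable_fun setT (V : T -> K) by exact: measurable_uniform_power.
transitivity (P (V @^-1` (A `&` `]0, +oo[))).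
  rewrite -[LHS]/(pushforward_measure P mV A) (measureDI _ mA mD).
  rewrite [X in (X + _)%E = _](_ : _ = 0%E) ?add0e//= /pushforward.
  rewrite uniform_powerE; last exact: measurableD.
  apply: (@subset_measure0 _ _ K lambda _ [set (0 : K)]) => //.
  - apply: measurableI => //.
    rewrite -[X in measurable X]setTI; apply: (measurable_powR _) => //.
    exact: measurableD.
  - move=> u /=; rewrite !in_itv/= andbT => -[/andP[u0 _] [_ /negP]].
    rewrite -leNgt => h; apply/eqP; rewrite eq_le u0 andbT leNgt.
    by apply/negP => u0'; move: h; rewrite leNgt powR_gt0.
  - exact: lebesgue_measure_set1.
transitivity (density_measure (@lebesgue_measure K) mpd pd0 (A `&` `]0, +oo[)).
  rewrite -[LHS]/(pushforward_measure P mV _).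
  apply: (@eq_measure_rays K (pushforward_measure P mV)
    (borel_measure (density_measure (@lebesgue_measure K) mpd pd0))).
  - by move=> c c0; exact: uniform_power_gt.
  - move=> c c0; apply: le_lt_trans (ltry 1); apply: probability_le1.
    by rewrite -[X in measurable X]setTI; apply: mV.
  - exact: measurableI.
  - by move=> x [].
rewrite /density_measure integral_mkcondr; apply: eq_integral => x _.
rewrite patchE mem_setE/= in_itv/= andbT; case: ifPn => // /negbTE x0.
by rewrite /power_density x0.
Qed.

End uniform_power.

Section beta_power.
Context (K : realType) (d : measure_display) (T : measurableType d)
  (P : probability T K) (U : {RV P >-> K}).
Hypothesis U_unif : forall A : set K, measurable A ->
  distribution P U A = uniform_prob (@ltr01 K) A.
Variable delta : K.
Hypothesis delta0 : 0 < delta.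

(** The law of [U^(1/delta)] has total mass 1, which normalizes the beta integral
   without computing an improper one. *)
Let beta_functionE : beta_function delta 1 = delta^-1.
Proof.
have := uniform_power_law U_unif delta0 measurableT.
rewrite preimage_setT probability_setT.
have -> : (\int[@lebesgue_measure K]_x (power_density delta x)%:E =
    delta%:E * \int[@lebesgue_measure K]_(x in `]0%R, 1%R[) (x `^ (delta - 1))%:E)%E.
  rewrite -ge0_integralZl//.
  - rewrite [RHS]integral_mkcond; apply: eq_integral => x _.
    by rewrite patchE mem_setE/= in_itv/= /power_density; case: ifP.
  - by apply/measurable_EFinP; exact: measurable_funTS.
  - by move=> x _; rewrite lee_fin powR_ge0.
  - by rewrite lee_fin ltW.
rewrite /beta_function /Rintegral => h.
under eq_integral do rewrite subrr powRr0 mulr1.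
move: h; case: (integral _ _ _) => [r|/eqP|/eqP]/=.
- by rewrite -EFinM => -[h]; rewrite -[delta^-1]mulr1 h mulKf// gt_eqF.
- by rewrite mulry gtr0_sg// mul1e.
- by rewrite mulrNy gtr0_sg// mul1e.
Qed.

Lemma beta_density_power (x : K) : beta_density delta 1 x = power_density delta x.
Proof.
rewrite /beta_density /power_density beta_functionE; case: ifPn => // _.
by rewrite subrr powRr0 mulr1 invrK mulrC.
Qed.

End beta_power.

(** * Independence *)

Section independence.
Context (K : realType) (d : measure_display) (T : measurableType d)
  (P : probability T K).

Lemma independent_rvC (X Y : {RV P >-> K}) :
  independent_rv X Y -> independent_rv Y X.
Proof. by move=> XY A B mA mB; rewrite setIC XY// muleC. Qed.

(** The joint law is the product of the two laws, since they agree on rectangles;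
   the rest is Tonelli. *)
Lemma independent_integral (X Y : {RV P >-> K}) (k : K * K -> \bar K) :
  independent_rv X Y -> measurable_fun setT k -> (forall z, (0 <= k z)%E) ->
  (\int[P]_w k (X w, Y w) = \int[P]_w \int[P]_w' k (X w, Y w'))%E.
Proof.
move=> XY mk k0.
have mXY : measurable_fun setT (fun w => (X w, Y w)).
  by apply: measurable_fun_pair.
transitivity (\int[pushforward_measure P mXY]_z k z)%E.
  by rewrite ge0_integral_pushforward.
transitivity (\int[distribution P X \x distribution P Y]_z k z)%E.
  apply: eq_measure_integral => A mA _; apply/esym.
  apply: (@product_measure_unique _ _ _ _ _ (distribution P X) (distribution P Y)
    (pushforward_measure P mXY)) => //.
rewrite fubini_tonelli1// /fubini_F ge0_integral_distribution//; last 2 first.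
- exact: measurable_fun_fubini_tonelli_F.
- by move=> x; exact: integral_ge0.
apply: eq_integral => w _ /=; rewrite ge0_integral_distribution//.
exact: measurableT_comp.
Qed.

End independence.

Lemma eq_law_integral (K : realType)
    (d1 : measure_display) (T1 : measurableType d1) (P1 : probability T1 K)
    (d2 : measure_display) (T2 : measurableType d2) (P2 : probability T2 K)
    (d : measure_display) (S : measurableType d) (X1 : T1 -> S) (X2 : T2 -> S)
    (f : S -> \bar K) : eq_law P1 P2 X1 X2 ->
  measurable_fun setT f -> (forall x, (0 <= f x)%E) ->
  (\int[P1]_w f (X1 w) = \int[P2]_w f (X2 w))%E.
Proof.
move=> [mX1 mX2 X12] mf f0.
transitivity (\int[pushforward_measure P1 mX1]_x f x)%E.
  by rewrite ge0_integral_pushforward.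
transitivity (\int[pushforward_measure P2 mX2]_x f x)%E.
  by apply: eq_measure_integral => A mA _; exact: X12.
by rewrite ge0_integral_pushforward.
Qed.

(** * A scaled power leaves a constant cofactor *)

Section scaled_uniform_power.
Context (K : realType) (d : measure_display) (T : measurableType d)
  (P : probability T K) (R Y U : {RV P >-> K}) (delta c : K).
Hypothesis U_unif : forall A : set K, measurable A ->
  distribution P U A = uniform_prob (@ltr01 K) A.
Hypothesis delta0 : 0 < delta.
Hypothesis c0 : 0 < c.
Hypothesis R_pos : forall w, 0 < R w.
Hypothesis Y_pos : forall w, 0 < Y w.
Hypothesis YR : independent_rv Y R.
Local Notation V := (fun w => U w `^ delta^-1).
Hypothesis RY_law : eq_law P P (fun w => R w * Y w) V.
Hypothesis R_law : eq_law P P R (fun w => c * V w).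

Let moment n (X : T -> K) : \bar K := (\int[P]_w (`|X w| ^+ n)%:E)%E.

Let mpow n : measurable_fun setT (fun x : K => (`|x| ^+ n)%:E).
Proof.
by apply/measurable_EFinP; apply: measurable_funX; exact: normr_measurable.
Qed.

Let momentM n : moment n (fun w => R w * Y w) = (moment n R * moment n Y)%E.
Proof.
have mk : measurable_fun setT (fun z : K * K => (`|z.1 * z.2| ^+ n)%:E).
  by apply: (measurableT_comp (mpow n)); exact: measurable_funM.
rewrite /moment (@independent_integral _ _ _ _ R Y (fun z => (`|z.1 * z.2| ^+ n)%:E))//.
  transitivity (\int[P]_w ((`|R w| ^+ n)%:E * moment n Y))%E.
    apply: eq_integral => w _ /=.
    under eq_integral do rewrite normrM exprMn EFinM.
    by rewrite ge0_integralZl//; exact: (measurableT_comp (mpow n)).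
  rewrite ge0_integralZr//; first exact: (measurableT_comp (mpow n)).
  exact: integral_ge0.
exact: independent_rvC.
Qed.

Let momentZ n (X : T -> K) : measurable_fun setT X ->
  moment n (fun w => c * X w) = ((c ^+ n)%:E * moment n X)%E.
Proof.
move=> mX; rewrite /moment.
under eq_integral do rewrite normrM (gtr0_norm c0) exprMn EFinM.
rewrite ge0_integralZl//; first exact: (measurableT_comp (mpow n)).
by rewrite lee_fin exprn_ge0// ltW.
Qed.

Let moment_V_fin n : (moment n V < +oo)%E.
Proof.
rewrite /moment (@ge0_integral_uniform_rv _ _ _ _ _ U_unif
  (fun u => (`|u `^ delta^-1| ^+ n)%:E)).
- apply: (@le_lt_trans _ _ (\int[lebesgue_measure]_(u in `[0%R, 1%R]) (cst 1 u))%E).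
    apply: ge0_le_integral => //.
      by apply: measurable_funTS; exact: (measurableT_comp (mpow n)).
    move=> u /=; rewrite in_itv/= => /andP[u0 u1]; rewrite lee_fin exprn_ile1//.
    have <- : 1 `^ delta^-1 = 1 :> K by rewrite powR1.
    by rewrite ger0_norm ?powR_ge0// ge0_ler_powR ?nnegrE// invr_ge0 ltW.
  rewrite integral_cst//= mul1e lebesgue_measure_itv/= lte_fin ltr01.
  by rewrite oppr0 adde0 ltry.
- exact: (measurableT_comp (mpow n)).
- by [].
Qed.

(** [V] has the law of [R Y], which is positive. *)
Let moment_V_gt0 n : (0 < moment n V)%E.
Proof.
have -> : moment n V = moment n (fun w => R w * Y w).
  by apply/esym; exact: (eq_law_integral RY_law (mpow n)).
rewrite lt0e integral_ge0// andbT; apply/eqP => h.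
have := @ae_eq_integral_abs _ _ _ P setT measurableT
  (fun w => (`|R w * Y w| ^+ n)%:E) _.
have mm : measurable_fun setT (fun w => (`|R w * Y w| ^+ n)%:E).
  by apply: (measurableT_comp (mpow n)); exact: measurable_funM.
move=> /(_ mm)[+ _].
under eq_integral do rewrite gee0_abs//.
move=> /(_ h)[N [mN N0]] sub.
have NT : N = setT.
  rewrite -subTset => w _; apply: sub => /= /(_ I) /eqP.
  by rewrite eqe expf_eq0 normr_eq0 mulf_eq0 !gt_eqF// andbF.
have := probability_setT P; rewrite -NT.
by move: N0 => /= -> /eqP; rewrite eq_sym onee_eq0.
Qed.

Let moment_Y n : moment n Y = (c ^- n)%:E.
Proof.
have mV := measurable_uniform_power U delta.
have h : moment n V = (((c ^+ n)%:E * moment n V) * moment n Y)%E.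
  rewrite -momentZ// /moment.
  rewrite -[X in (X * _)%E](eq_law_integral R_law (mpow n))//.
  rewrite -/(moment n R) -/(moment n Y) -momentM.
  by apply/esym; exact: (eq_law_integral RY_law (mpow n)).
have := moment_V_fin n; have := moment_V_gt0 n; have : (0 <= moment n Y)%E by exact: integral_ge0.
move: h; move: (moment n V) (moment n Y) => [v||//] [y||//]//=.
- rewrite -!EFinM lte_fin => -[h] _ v0 _; congr EFin.
  apply: (mulfI (lt0r_neq0 (mulr_gt0 (exprn_gt0 n c0) v0))).
  by rewrite -h mulrAC divff ?mul1r// expf_neq0// gt_eqF.
- rewrite -EFinM => h _; rewrite lte_fin => v0 _.
  by move: h; rewrite gt0_muley// lte_fin mulr_gt0// exprn_gt0.
Qed.

(** Comparing the first two moments on both sides of [R Y ~ R / c] gives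
   [E Y = 1/c] and [E Y^2 = 1/c^2], so [Y] has no variance. *)
Lemma scaled_uniform_power_cst : {ae P, forall w, Y w = c^-1}.
Proof.
have mY : measurable_fun setT (Y : T -> K) by [].
have mS : measurable_fun setT (fun w => ((c * Y w - 1) ^+ 2)%:E).
  apply/measurable_EFinP; apply: measurable_funX; apply: measurable_funB => //.
  exact: measurable_funM.
have sq : (\int[P]_w ((c * Y w - 1) ^+ 2)%:E = 0)%E.
  have h : (\int[P]_w ((c * Y w - 1) ^+ 2)%:E + (2 * c)%:E * moment 1 Y =
      (c ^+ 2)%:E * moment 2 Y + 1)%E.
    rewrite /moment -!ge0_integralZl//=; first last.
    - by rewrite lee_fin mulr_ge0// ltW.
    - by apply: (measurableT_comp (mpow _)).
    - by rewrite lee_fin exprn_ge0// ltW.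
    - by apply: (measurableT_comp (mpow _)).
    have {1}-> : (1 = \int[P]_w (cst 1 w))%E.
      by rewrite integral_cst// mul1e; exact/esym/probability_setT.
    rewrite -!ge0_integralD//; first last.
    - by apply: emeasurable_funM => //; apply: (measurableT_comp (mpow _)).
    - by move=> w _; rewrite mule_ge0// lee_fin mulr_ge0// ltW.
    - by move=> w _; rewrite lee_fin sqr_ge0.
    - by apply: emeasurable_funM => //; apply: (measurableT_comp (mpow _)).
    - by move=> w _; rewrite mule_ge0// lee_fin exprn_ge0// ltW.
    apply: eq_integral => w _; rewrite -!EFinM -!EFinD; congr EFin.
    by rewrite (gtr0_norm (Y_pos w)) expr1; ring.
  move: h; rewrite !moment_Y -!EFinM expr1 -mulrA divff ?gt_eqF// mulr1.
  rewrite divff ?expf_neq0 ?gt_eqF//.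
  case: (integral _ _ _) => [r|//|//].
  by rewrite -!EFinD => -[h]; congr EFin; lra.
have := @ae_eq_integral_abs _ _ _ P setT measurableT
  (fun w => ((c * Y w - 1) ^+ 2)%:E) mS.
under eq_integral do rewrite gee0_abs ?lee_fin ?sqr_ge0//.
move=> [/(_ sq) h _]; apply: filterS h => w /(_ I) /eqP.
rewrite eqe sqrf_eq0 subr_eq0 => /eqP e.
by rewrite -[LHS](mulKf (lt0r_neq0 c0)) e mulr1.
Qed.

End scaled_uniform_power.

(** * Inverting the mixture over a power of a uniform variable *)

Section power_mixture.
Context (K : realType) (m : {measure set K -> \bar K}) (delta : K).
Hypothesis m_int : (\int[m]_(s in `]0%R, +oo[) (Num.min 1 s)%:E < +oo)%E.
Hypothesis delta0 : 0 < delta.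
Local Notation psi := (laplace_exponent_of m).
Local Notation lambda := (@lebesgue_measure K).
Variable phi : K -> K.
Hypothesis phiE : forall w : K, 0 < w ->
  (phi w)%:E = (\int[lambda]_(u in `[0%R, 1%R]) (psi (w * u `^ delta^-1))%:E)%E.

Let g (s : K) : K := psi `|s `^ delta^-1|.

Let mg : measurable_fun setT g.
Proof.
apply: (measurableT_comp (measurable_laplace_exponent_of m_int)).
exact: measurable_powR.
Qed.

Let g_ge0 s : 0 <= g s.
Proof. exact: (laplace_exponent_of_ge0 m_int). Qed.

Let g_le (s u : K) : 0 <= s -> s <= u -> g s <= g u.
Proof.
move=> s0 su; apply: (laplace_exponent_of_le m_int) => //.
rewrite !ger0_norm ?powR_ge0// ge0_ler_powR ?nnegrE ?invr_ge0// ?(ltW delta0)//.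
exact: le_trans su.
Qed.

Let g_continuous (s : K) : 0 < s -> {for s, continuous g}.
Proof.
move=> s0; apply: (@continuous_comp _ _ _ (fun s : K => s `^ delta^-1) (fun x => psi `|x|)).
  exact: continuous_powR_pos.
exact: (continuous_laplace_exponent_of m_int).
Qed.

Let g_integrable (a : K) : lambda.-integrable `[0, a] (EFin \o g).
Proof.
apply: measurable_bounded_integrable => //.
- by rewrite /= lebesgue_measure_itv/=; case: ifP => _; rewrite ltry.
- exact: measurable_funTS.
- exists (g a); split; first exact: num_real.
  move=> M aM s /=; rewrite in_itv/= => /andP[s0 sa].
  rewrite (ger0_norm (g_ge0 s)); exact: le_trans (g_le s0 sa) (ltW aM).
Qed.

Let G (x : K) : K := \int[lambda]_(s in `[0, x]) g s.

(** Substituting [s = w^delta u] turns the mixture into a primitive evaluated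
   at [w^delta]. *)
Let phi_G (w : K) : 0 < w -> phi w = (w `^ delta)^-1 * G (w `^ delta).
Proof.
move=> w0; apply: EFin_inj; rewrite (phiE w0).
have a0 : 0 < w `^ delta by exact: powR_gt0.
have gE (u : K) : 0 <= u -> psi (w * u `^ delta^-1) = g (w `^ delta * u).
  move=> u0; rewrite /g powRM ?powR_ge0// -powRrM divff ?gt_eqF// powRr1 ?(ltW w0)//.
  by rewrite ger0_norm// mulr_ge0 ?powR_ge0// ltW.
move: (w `^ delta) a0 gE => a a0 gE.
transitivity (\int[lambda]_(u in *%R a @^-1` `[0%R, a]) (g (a * u))%:E)%E.
  have -> : *%R a @^-1` `[0, a] = `[0, 1]%classic.
    apply/seteqP; split=> u /=; rewrite !in_itv/= pmulr_rge0//.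
      by rewrite -{2}[a]mulr1 ler_pM2l.
    by rewrite -{2}[a]mulr1 ler_pM2l.
  by apply: eq_integral => u; rewrite inE/= in_itv/= => /andP[u0 u1]; rewrite gE.
have ga0 (x : K) : `[0, a]%classic x -> (0 <= (g x)%:E)%E.
  by move=> _; rewrite lee_fin; exact: g_ge0.
have mga : measurable_fun `[0, a] (EFin \o g).
  by apply/measurable_EFinP; exact: (measurable_funTS mg).
rewrite (ge0_integral_scale a0 (measurable_itv `[0, a]) mga ga0).
rewrite EFinM /G /Rintegral fineK; first by [].
exact: (integrable_fin_num _ (g_integrable _)).
Qed.

(** [psi] is nondecreasing and [u^(1/delta) <= 1]. *)
Lemma power_mixture_le (w : K) : 0 < w -> phi w <= psi w.
Proof.
move=> w0; rewrite -lee_fin phiE//.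
apply: (@le_trans _ _ (\int[lambda]_(u in `[0%R, 1%R]) (cst (psi w)%:E u))%E).
  apply: ge0_le_integral => //.
  - move=> u _; rewrite lee_fin; apply: (laplace_exponent_of_ge0 m_int).
    by rewrite mulr_ge0 ?powR_ge0// ltW.
  - rewrite (_ : (fun u : K => _) = (fun u : K => (psi `|w * u `^ delta^-1|)%:E)).
      apply/measurable_EFinP; apply: measurable_funTS.
      apply: (measurableT_comp (measurable_laplace_exponent_of m_int)).
      by apply: measurable_funM.
    by apply/funext => u; rewrite ger0_norm// mulr_ge0 ?powR_ge0// ltW.
  - move=> u /=; rewrite in_itv/= => /andP[u0 u1]; rewrite lee_fin.
    apply: (laplace_exponent_of_le m_int); first by rewrite mulr_ge0 ?powR_ge0// ltW.
    rewrite ler_piMr ?(ltW w0)//.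
    have <- : 1 `^ delta^-1 = 1 :> K by rewrite powR1.
    by rewrite ge0_ler_powR ?nnegrE// invr_ge0 ltW.
rewrite integral_cst//= lebesgue_measure_itv/= lte_fin ltr01.
by rewrite oppr0 adde0 mule1.
Qed.

Let G_derive (x : K) : 0 < x -> is_derive x 1 G (g x).
Proof.
move=> x0.
have [] := @continuous_FTC1_closed K g 0 x (x + 1) _ (g_integrable _) x0 (g_continuous x0).
  by rewrite ltrDl.
by move=> dG <-; rewrite derive1E; exact: derivableP.
Qed.

(** Differentiating [w^delta phi w = G (w^delta)], where [G' s = psi (s^(1/delta))]
   by continuity of [psi]. *)
Lemma power_mixture_derive (w : K) : 0 < w ->
  derivable phi w 1 /\ psi w = phi w + delta^-1 * w * derive1 phi w.
Proof.
move=> w0; have a0 : 0 < w `^ delta by rewrite powR_gt0.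
pose p (x : K) := x `^ delta.
have dp : is_derive w 1 p (delta * w `^ (delta - 1)) by exact: is_derive1_powR.
have dGp : is_derive w 1 (G \o p) (g (p w) * (delta * w `^ (delta - 1))).
  exact: (@is_derive1_comp _ G p w _ _ (G_derive (a0 : 0 < p w)) dp).
have dV : is_derive w 1 (fun x => (p x)^-1) (- (p w) ^- 2 *: (delta * w `^ (delta - 1))).
  by apply: is_deriveV; rewrite gt_eqF.
have dphi : is_derive w 1 phi (delta * w^-1 * (psi w - phi w)).
  apply: (@near_eq_is_derive _ _ _ ((fun x => (p x)^-1) * (G \o p))).
    by near=> x; rewrite [RHS]phi_G//; near: x; exact: lt_nbhsr.
  suff -> : delta * w^-1 * (psi w - phi w) =
      (p w)^-1 *: (g (p w) * (delta * w `^ (delta - 1))) +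
      (G \o p) w *: (- (p w) ^- 2 *: (delta * w `^ (delta - 1))).
    exact: is_deriveM.
  have -> : g (p w) = psi w.
    by rewrite /g /p -powRrM divff ?gt_eqF// powRr1 ?(ltW w0)// gtr0_norm.
  rewrite phi_G// -/(p w) /=.
  have -> : w `^ (delta - 1) = p w / w.
    by rewrite /p -(mulr_powRB1 (ltW w0) delta0) mulrAC divff ?mul1r// gt_eqF.
  rewrite /GRing.scale/=; field.
  by rewrite !gt_eqF.
split; first exact: ex_derive.
rewrite derive1E derive_val; field.
by rewrite !gt_eqF.
Unshelve. all: by end_near. Qed.

End power_mixture.

(** * Random scaling of an exponent *)

Section random_scaling.
Context (K : realType) (d : measure_display) (T : measurableType d)
  (P : probability T K) (Y : {RV P >-> K}).
Hypothesis Y_pos : forall w, 0 < Y w.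
Variables (mZ mzeta : {measure set K -> \bar K}) (delta : K).
Hypothesis mZ_int : (\int[mZ]_(s in `]0%R, +oo[) (Num.min 1 s)%:E < +oo)%E.
Hypothesis mzeta_int : (\int[mzeta]_(s in `]0%R, +oo[) (Num.min 1 s)%:E < +oo)%E.
Hypothesis delta0 : 0 < delta.
Local Notation psi := (laplace_exponent_of mZ).
Local Notation phi := (laplace_exponent_of mzeta).

Lemma measurable_laplace_exponent_scaled (m : {measure set K -> \bar K}) (w : K) :
  (\int[m]_(s in `]0%R, +oo[) (Num.min 1 s)%:E < +oo)%E -> 0 < w ->
  measurable_fun setT (fun x => (laplace_exponent_of m (w * Y x))%:E).
Proof.
move=> m_int w0; apply/measurable_EFinP.
rewrite (_ : (fun x => _) = (fun x => laplace_exponent_of m `|w * Y x|)).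
  apply: (measurableT_comp (measurable_laplace_exponent_of m_int)).
  exact: measurable_funM.
by apply/funext => x; rewrite gtr0_norm// mulr_gt0.
Qed.

Hypothesis phi_le : forall w : K, 0 < w -> phi w <= psi w.
Hypothesis psiE : forall w : K, 0 < w ->
  psi w = phi w + delta^-1 * w * derive1 phi w.

(** The pointwise identity [psiE] at [w Y], integrated.  The derivative term is
   nonnegative because [phi <= psi], so its expectation adds up even when it is
   infinite. *)
Lemma mixture_derivative (w : K) : 0 < w ->
  'E_P[fun x => psi (w * Y x)]%E =
  ('E_P[fun x => phi (w * Y x)] + (delta^-1 * w)%:E *
   'E_P[fun x => (Y x * derive1 phi (w * Y x))%R])%E.
Proof.
move=> w0; rewrite unlock.
have wY x : 0 < w * Y x by rewrite mulr_gt0.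
have c0 : 0 < delta^-1 * w by rewrite mulr_gt0// invr_gt0.
have YE x : Y x * derive1 phi (w * Y x) = (psi (w * Y x) - phi (w * Y x)) / (delta^-1 * w).
  by rewrite psiE//; field; rewrite !gt_eqF.
under [X in (_ + _ * X)%E]eq_integral do rewrite YE.
have mpsi := measurable_laplace_exponent_scaled mZ_int w0.
have mphi := measurable_laplace_exponent_scaled mzeta_int w0.
have D0 x : 0 <= (psi (w * Y x) - phi (w * Y x)) / (delta^-1 * w).
  by rewrite divr_ge0 ?(ltW c0)// subr_ge0 phi_le.
have mD : measurable_fun setT
    (fun x => ((psi (w * Y x) - phi (w * Y x)) / (delta^-1 * w))%:E).
  apply/measurable_EFinP; apply: measurable_funM => //.
  by apply: measurable_funB; apply/measurable_EFinP.
rewrite -ge0_integralZl//; last 2 first.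
- by move=> x _; rewrite lee_fin.
- by rewrite lee_fin ltW.
rewrite -ge0_integralD//; last 3 first.
- by move=> x _; rewrite lee_fin (laplace_exponent_of_ge0 mzeta_int)// ltW.
- by move=> x _; rewrite -EFinM lee_fin mulr_ge0// ltW.
- exact: emeasurable_funM.
apply: eq_integral => x _; rewrite -EFinM -EFinD; congr EFin.
by rewrite mulrCA divff ?gt_eqF// mulr1 addrC subrK.
Qed.

End random_scaling.

(** * Densities of scaled mixtures *)

Section density_mixture.
Context (K : realType) (d : measure_display) (T : measurableType d)
  (P : probability T K) (Y : {RV P >-> K}).
Hypothesis Y_pos : forall w, 0 < Y w.
Variables (mZ : {measure set K -> \bar K}) (rho : K -> K).
Local Notation lambda := (@lebesgue_measure K).
Local Notation D := (`]0, +oo[%classic : set K).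
Hypothesis mrho : measurable_fun D rho.
Hypothesis rho_ge0 : forall x, 0 < x -> 0 <= rho x.
Hypothesis mZE : forall A : set K, measurable A -> A `<=` D ->
  mZ A = (\int[lambda]_(x in A) (rho x)%:E)%E.

Let mD : measurable (D : set K).
Proof. exact: measurable_itv. Qed.

Let Dpos (s : K) : D s -> 0 < s.
Proof. by rewrite /= in_itv/= andbT. Qed.

(** A total version of the density, so that Tonelli applies on the whole line. *)
Let r : K -> K := rho \_ D.

Let mr : measurable_fun setT r.
Proof. exact: (measurable_restrictT _ mD).1. Qed.

Let r_ge0 x : 0 <= r x.
Proof. by rewrite /r patchE; case: ifPn => //; rewrite inE => /Dpos/rho_ge0. Qed.

Let rE x : 0 < x -> r x = rho x.
Proof. by move=> x0; rewrite /r patchE mem_setE/= in_itv/= x0. Qed.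

Let mEr : measurable_fun setT (EFin \o r).
Proof. exact/measurable_EFinP. Qed.

Let Er_ge0 x : (0 <= (EFin \o r) x)%E.
Proof. by rewrite lee_fin. Qed.

Let integral_mZ (h : K -> \bar K) : measurable_fun setT h -> (forall x, (0 <= h x)%E) ->
  (\int[mZ]_(z in D) h z = \int[lambda]_(z in D) (h z * (r z)%:E))%E.
Proof.
move=> mh h0.
transitivity (\int[borel_measure (density_measure lambda mEr Er_ge0)]_(z in D) h z)%E.
  apply: eq_measure_integral => A mA AD.
  rewrite mZE//= /pushforward/= /density_measure.
  by apply: eq_integral => x; rewrite inE => /AD/Dpos/rE /= ->.
rewrite ge0_integral_borel//; last exact: measurable_funTS.
rewrite integral_mkcond ge0_integral_density//.
- rewrite [RHS]integral_mkcond; apply: eq_integral => x _.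
  by rewrite !patchE; case: ifP => // _; rewrite mul0e.
- by apply/(measurable_restrictT _ _).1 => //; exact: measurable_funTS.
- by move=> x; rewrite patchE; case: ifP.
Qed.

Let ker (z : K * T) : \bar K := (r (z.1 / Y z.2) * (Y z.2)^-1)%:E.

Let mker : measurable_fun setT ker.
Proof.
have mYi : measurable_fun setT (fun z : K * T => (Y z.2)^-1).
  rewrite (_ : (fun z => _) = (fun z : K * T => Y z.2 `^ (- 1))).
    apply: (measurableT_comp (measurable_powR _)).
    by apply: (@measurableT_comp _ _ _ _ _ _ (Y : T -> K)).
  by apply/funext => z; rewrite powR_inv1// ltW.
apply/measurable_EFinP; apply: measurable_funM => //.
apply: (measurableT_comp mr); apply: measurable_funM => //; exact: mYi.
Qed.

Let ker_ge0 z : (0 <= ker z)%E.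
Proof. by rewrite lee_fin mulr_ge0// invr_ge0 ltW. Qed.

Definition mixture_density (x : K) : \bar K := (\int[P]_w (r (x / Y w) * (Y w)^-1)%:E)%E.

Lemma mixture_densityE x : 0 < x ->
  mixture_density x = 'E_P[fun w => (rho (x / Y w) * (Y w)^-1)%R]%E.
Proof.
move=> x0; rewrite unlock; apply: eq_integral => w _.
by rewrite rE// divr_gt0.
Qed.

Lemma measurable_mixture_density : measurable_fun setT mixture_density.
Proof. exact: (@measurable_fun_fubini_tonelli_F _ _ _ _ _ P ker mker ker_ge0). Qed.

Lemma mixture_density_ge0 x : (0 <= mixture_density x)%E.
Proof. by apply: integral_ge0 => w _; exact: (ker_ge0 (x, w)). Qed.

(** Tonelli, then the substitution [x = Y z] for each value of [Y]. *)
Lemma integral_mixture_density (g : K -> \bar K) : measurable_fun setT g ->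
  (forall x, (0 <= g x)%E) ->
  (\int[lambda]_(x in D) (g x * mixture_density x) =
   \int[P]_w \int[mZ]_(z in D) g (Y w * z)%R)%E.
Proof.
move=> mg g0.
pose f (z : measurableTypeR K * T) : \bar K := ((g \_ D) z.1 * ker z)%E.
have mgD : measurable_fun setT (g \_ D).
  by apply/(measurable_restrictT _ _).1 => //; exact: measurable_funTS.
have gD0 x : (0 <= (g \_ D) x)%E by rewrite patchE; case: ifP.
have mf : measurable_fun setT f.
  have h : measurable_fun setT (fun z : K * T => (g \_ D) z.1 * ker z)%E.
    by apply: emeasurable_funM => //; exact: (measurableT_comp mgD).
  exact: h.
have f0 z : (0 <= f z)%E by rewrite mule_ge0.
transitivity (\int[lambda]_x \int[P]_w f (x, w))%E.
  rewrite integral_mkcond; apply: eq_integral => x _.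
  have mkx : measurable_fun setT (fun w => ker (x, w)) by apply: (measurableT_comp mker).
  rewrite /f/= ge0_integralZl//.
  by rewrite !patchE; case: ifP => // _; rewrite mul0e.
rewrite (fubini_tonelli f mf f0); apply: eq_integral => w _.
rewrite integral_mZ//; last by apply: (measurableT_comp mg).
have Yw := Y_pos w.
have -> : (D : set K) = *%R (Y w) @^-1` D.
  by apply/seteqP; split=> x /=; rewrite !in_itv/= !andbT pmulr_rgt0.
pose f1 x := (g x * (r (x / Y w))%:E)%E.
have mf1 : measurable_fun D f1.
  apply: measurable_funTS; apply: emeasurable_funM => //; apply/measurable_EFinP.
  by apply: (measurableT_comp mr); exact: measurable_funM.
have f10 x : D x -> (0 <= f1 x)%E by move=> _; rewrite mule_ge0// lee_fin.
transitivity (\int[lambda]_(z in *%R (Y w) @^-1` D) f1 (Y w * z)%R)%E; last first.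
  apply: eq_integral => x _; rewrite /f1 mulrAC divff ?mul1r// gt_eqF//.
rewrite (ge0_integral_scale Yw mD mf1 f10) -ge0_integralZl//; last first.
  by rewrite lee_fin invr_ge0 ltW.
rewrite [RHS]integral_mkcond; apply: eq_integral => x _.
rewrite /f /ker/= !patchE; case: ifP => _; last by rewrite mul0e.
by rewrite /f1 EFinM muleA muleC.
Qed.

End density_mixture.

(** * The two descriptions of the driving subordinator *)

Section mixture_levy.
Context (K : realType) (d : measure_display) (T : measurableType d)
  (P : probability T K) (Y : {RV P >-> K}).
Hypothesis Y_pos : forall w, 0 < Y w.
Variables (mZ mL : {measure set K -> \bar K}) (rho : K -> K).
Hypothesis mZ_int : (\int[mZ]_(s in `]0%R, +oo[) (Num.min 1 s)%:E < +oo)%E.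
Hypothesis mL_int : (\int[mL]_(s in `]0%R, +oo[) (Num.min 1 s)%:E < +oo)%E.
Local Notation lambda := (@lebesgue_measure K).
Local Notation D := (`]0, +oo[%classic : set K).
Hypothesis mrho : measurable_fun D rho.
Hypothesis rho_ge0 : forall x, 0 < x -> 0 <= rho x.
Hypothesis mZE : forall A : set K, measurable A -> A `<=` D ->
  mZ A = (\int[lambda]_(x in A) (rho x)%:E)%E.
Local Notation psi := (laplace_exponent_of mZ).
Local Notation h := (mixture_density Y rho).

Let Dpos (s : K) : D s -> 0 < s.
Proof. by rewrite /= in_itv/= andbT. Qed.

Let mh : measurable_fun setT h := measurable_mixture_density Y_pos mrho rho_ge0.
Let h0 x : (0 <= h x)%E := mixture_density_ge0 Y_pos rho_ge0 x.
Let nu : {measure set K -> \bar K} := borel_measure (density_measure lambda mh h0).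

Let nu_exponent (w : K) : 0 < w ->
  (\int[nu]_(x in D) (1 - expR (- (w * x)))%:E = 'E_P[fun v => psi (w * Y v)])%E.
Proof.
move=> w0.
pose g (x : K) : \bar K := (`|1 - expR (- (w * x))|)%:E.
have mg : measurable_fun setT g.
  apply/measurable_EFinP; apply: measurableT_comp => //.
  exact: measurable_onem_expR.
have g0 x : (0 <= g x)%E by rewrite lee_fin.
have gE (a : K) x : 0 < a -> D x -> (1 - expR (- (w * (a * x))))%:E = g (a * x).
  by move=> a0 /Dpos x0; rewrite /g ger0_norm// onem_expR_ge0 ?(ltW w0)// ltW// mulr_gt0.
transitivity (\int[nu]_(x in D) g x)%E.
  by apply: eq_integral => x; rewrite inE => /(gE 1 _ ltr01); rewrite mul1r.
rewrite ge0_integral_borel//; last exact: measurable_funTS.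
transitivity (\int[lambda]_(x in D) (g x * h x))%E.
  rewrite integral_mkcond ge0_integral_density//.
  - rewrite [RHS]integral_mkcond; apply: eq_integral => x _.
    by rewrite !patchE; case: ifP => // _; rewrite mul0e.
  - by apply/(measurable_restrictT _ _).1 => //; exact: measurable_funTS.
  - by move=> x; rewrite patchE; case: ifP.
rewrite (integral_mixture_density Y_pos mrho rho_ge0 mZE mg g0) unlock.
apply: eq_integral => v _; rewrite (laplace_exponent_ofE mZ_int).
  apply: eq_integral => x; rewrite inE => Dx; rewrite -gE//.
  by rewrite mulrA.
by rewrite mulr_ge0 ?ltW.
Qed.

Let nuE (A : set K) : A `<=` D ->
  nu A = (\int[lambda]_(x in A) 'E_P[fun w => (rho (x / Y w) * (Y w)^-1)%R])%E.
Proof.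
move=> AD; apply: eq_integral => x; rewrite inE => /AD/Dpos x0.
exact: mixture_densityE.
Qed.

(** The measure [nu] whose density is the mixture of [rho] has Laplace exponent
   ['E psi (w Y)], so the claim is that [mL] and [nu] have the same exponent if
   and only if they agree on the half-line. *)
Lemma mixture_levy_density :
  (forall w : K, 0 < w ->
    (laplace_exponent_of mL w)%:E = 'E_P[fun v => psi (w * Y v)]%E) <->
  [/\ measurable_fun D (fun x => 'E_P[fun w => (rho (x / Y w) * (Y w)^-1)%R]%E),
      forall x, 0 < x -> (0 <= 'E_P[fun w => (rho (x / Y w) * (Y w)^-1)%R])%E &
      forall A : set K, measurable A -> A `<=` D ->
        mL A = (\int[lambda]_(x in A) 'E_P[fun w => (rho (x / Y w) * (Y w)^-1)%R])%E].
Proof.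
split=> [H|[_ _ mLE] w w0].
- split.
  + apply: (@eq_measurable_fun _ _ _ _ _ h); last exact: measurable_funTS.
    by move=> x; rewrite inE => /Dpos x0; exact: mixture_densityE.
  + by move=> x x0; rewrite -mixture_densityE.
  + move=> A mA AD; rewrite -nuE//; apply: laplace_exponent_unique => // w w0.
      rewrite nu_exponent// -H//; apply/esym.
      by rewrite (laplace_exponent_ofE mL_int)// ltW.
    by rewrite -(laplace_exponent_ofE mL_int) ?ltry// ltW.
- rewrite (laplace_exponent_ofE mL_int) ?(ltW w0)// -nu_exponent//.
  by apply: eq_measure_integral => A mA AD; rewrite mLE// -nuE.
Qed.

End mixture_levy.

(** * The quantile function *)

Section quantile_theory.
Context (K : realType) (d : measure_display) (T : measurableType d)
  (P : probability T K) (X : {RV P >-> K}) (b : K).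
Hypothesis b0 : 0 <= b.
Hypothesis cdf_b : cdf X b = 1%E.
Local Notation q := (quantile X).
Local Notation lambda := (@lebesgue_measure K).
Implicit Types u v x s : K.

Let S u : set K := [set x | 0 <= x /\ (u%:E <= cdf X x)%E].

Let S_b u : u <= 1 -> S u b.
Proof. by move=> u1; split; rewrite // cdf_b lee_fin. Qed.

Let S_lb u : lbound (S u) 0.
Proof. by move=> x []. Qed.

Let S_has_inf u : u <= 1 -> has_inf (S u).
Proof. by move=> u1; split; [exists b; exact: S_b|exists 0; exact: S_lb]. Qed.

Lemma quantile_ge0 u : u <= 1 -> 0 <= q u.
Proof. by move=> u1; apply: lb_le_inf; [exists b; exact: S_b|exact: S_lb]. Qed.

Lemma quantile_le_bound u : u <= 1 -> q u <= b.
Proof. by move=> u1; apply: ge_inf; [exists 0; exact: S_lb|exact: S_b]. Qed.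

(** The infimum in the definition is attained, by right continuity of the
   distribution function. *)
Lemma quantile_le u x : u <= 1 -> 0 <= x -> (q u <= x) = (u%:E <= cdf X x)%E.
Proof.
move=> u1 x0; apply/idP/idP => [qx|ux]; last first.
  by apply: ge_inf; [exists 0; exact: S_lb|split].
have near_u : \forall y \near x^'+, (u%:E <= cdf X y)%E.
  near=> y; have xy : x < y by near: y; exact: nbhs_right_gt.
  have [z [z0 uz] zy] := inf_lt (S_has_inf u1).1 (le_lt_trans qx xy).
  exact: (le_trans uz (cdf_nondecreasing X (ltW zy))).
have := @cdf_right_continuous _ _ _ _ X x => cv.
exact: (cvge_to_ge cv near_u).
Unshelve. all: by end_near. Qed.

Lemma quantile_mono u v : u <= v -> v <= 1 -> q u <= q v.
Proof.
move=> uv v1; have u1 := le_trans uv v1.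
rewrite quantile_le ?quantile_ge0//.
by apply: (@le_trans _ _ v%:E); rewrite ?lee_fin// -quantile_le// quantile_ge0.
Qed.

Variable t : K.
Hypothesis t0 : 0 < t.

(** The integrand of the clock, made monotone on the whole line by clamping. *)
Definition clock_kernel s : K := q (Num.max 0 (1 - Num.max 0 s / t)).
Local Notation f := clock_kernel.

Let arg_le1 s : Num.max 0 (1 - Num.max 0 s / t) <= 1.
Proof.
rewrite ge_max ler01/= lerBlDr lerDl divr_ge0 ?(ltW t0)//.
by rewrite le_max lexx.
Qed.

Lemma clock_kernel_ge0 s : 0 <= f s.
Proof. exact/quantile_ge0/arg_le1. Qed.

Lemma clock_kernel_le s : f s <= b.
Proof. exact/quantile_le_bound/arg_le1. Qed.

Lemma clock_kernel_nonincreasing : nonincreasing_fun f.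
Proof.
move=> s s' ss'; apply: quantile_mono; last exact: arg_le1.
rewrite ge_max !le_max lexx/=; apply/orP; right.
rewrite lerD2l lerN2 ler_pM2r ?invr_gt0//.
by rewrite ge_max !le_max lexx/= ss' orbT.
Qed.

Lemma measurable_clock_kernel (D : set K) : measurable D -> measurable_fun D f.
Proof. by move=> mD; apply: nonincreasing_measurable => //; exact: clock_kernel_nonincreasing. Qed.

(** The Galois connection between the quantile and the distribution function. *)
Let gt_kernel c s : 0 <= c -> 0 <= s -> s <= t ->
  (c < f s) = (s < t * (1 - fine (cdf X c))).
Proof.
move=> c0 s0 st; rewrite ltNge quantile_le ?arg_le1//.
have -> : Num.max 0 (1 - Num.max 0 s / t) = 1 - s / t.
  rewrite (max_r s0) max_r// subr_ge0 ler_pdivrMr// mul1r//.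
have cE : cdf X c = (fine (cdf X c))%:E by rewrite fineK// fin_num_measure.
rewrite cE lee_fin -ltNge ltrBrDr addrC -ltrBrDr ltr_pdivrMr//.
by rewrite [t * _]mulrC.
Qed.

(** Left continuity of the quantile function. *)
Lemma clock_kernel_right_continuous (s : K) (u : nat -> K) : 0 <= s -> s <= t ->
  (forall n, s <= u n <= t) -> (u n @[n --> \oo] --> s) -> f (u n) @[n --> \oo] --> f s.
Proof.
move=> s0 st su cu; apply/cvgrPdist_lt => e e0.
have [h|h] := ltP (f s - e) 0.
  apply: nearW => n; have /andP[sun _] := su n.
  rewrite ger0_norm ?subr_ge0 ?clock_kernel_nonincreasing//.
  by have := clock_kernel_ge0 (u n); lra.
have /[dup] : f s - e < f s by rewrite ltrBlDr ltrDl.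
rewrite {1}gt_kernel// => sx _.
near=> n; have /andP[sun unt] := su n.
rewrite ger0_norm ?subr_ge0 ?clock_kernel_nonincreasing//.
rewrite ltrBlDr -ltrBlDl gt_kernel// ?(le_trans s0)//.
by near: n; exact: (cvgr_lt _ cu).
Unshelve. all: by end_near. Qed.

(** A ray above [c] has preimage [`]0, t (1 - F c)[], of length [t P (X > c)]. *)
Lemma clock_kernel_law (A : set K) : measurable A -> A `<=` `]0, +oo[ ->
  lambda (`]0, t] `&` f @^-1` A) = (t%:E * P (X @^-1` A))%E.
Proof.
move=> mA A0.
have mf : measurable_fun setT (f : measurableTypeR K -> K).
  have h : measurable_fun setT f by exact: measurable_clock_kernel.
  exact: h.
have mt : measurable (`]0, t]%classic : set (measurableTypeR K)) by exact: measurable_itv.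
pose m1 : {measure set K -> \bar K} := pushforward_measure (mrestr lambda mt) mf.
pose m2 : {measure set K -> \bar K} := mscale (NngNum (ltW t0)) (distribution P X).
have ray c : 0 < c -> m1 `]c, +oo[%classic = m2 `]c, +oo[%classic.
  move=> c0; have Fc : fine (cdf X c) <= 1.
    by rewrite -lee_fin fineK ?fin_num_measure// cdf_le1.
  have Fc0 : 0 <= fine (cdf X c) by rewrite fine_ge0.
  rewrite /m1 /m2/= /pushforward/= /mrestr /mscale/=.
  rewrite (_ : _ `&` _ = `]0, t * (1 - fine (cdf X c))[%classic); last first.
    apply/seteqP; split=> x /=; rewrite !in_itv/= ?andbT.
      by move=> [h /andP[x0 xt]]; rewrite x0/= -gt_kernel// ?(ltW c0)// ltW.
    move=> /andP[x0 h]; have xt : x <= t.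
      by rewrite (le_trans (ltW h))// ler_piMr ?(ltW t0)// lerBlDr lerDl.
    by rewrite gt_kernel ?(ltW c0) ?(ltW x0)// x0 xt h.
  have -> : distribution P X `]c, +oo[%classic = (1 - fine (cdf X c))%:E.
    rewrite -setCitvl probability_setC// EFinB fineK ?fin_num_measure//.
  rewrite lebesgue_measure_itv/= lte_fin; case: ifP => h; first by rewrite -EFinM oppr0 adde0.
  have : t * (1 - fine (cdf X c)) <= 0 by rewrite leNgt h.
  rewrite pmulr_rle0// -EFinM => h'.
  have -> : 1 - fine (cdf X c) = 0 by apply/eqP; rewrite eq_le h'/= subr_ge0.
  by rewrite mulr0.
have fin c : 0 < c -> (m1 `]c, +oo[%classic < +oo)%E.
  move=> c0; rewrite ray// /m2/= /mscale/= lte_mul_pinfty// ?lee_fin ?(ltW t0)//.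
  by apply: le_lt_trans (ltry 1); exact: probability_le1.
have := eq_measure_rays ray fin mA A0.
by rewrite /m1 /m2/= /pushforward/= /mrestr /mscale/= setIC.
Qed.

(** The kernel may take the value 0, which lies outside the range of [X]; a
   function that vanishes at 0 ignores it. *)
Lemma integral_clock_kernel (g : K -> \bar K) : measurable_fun setT g ->
  (forall x, (0 <= g x)%E) -> g 0 = 0%E -> (forall w, 0 < X w) ->
  (\int[lambda]_(s in `]0%R, t]) g (f s) = t%:E * \int[P]_w g (X w))%E.
Proof.
move=> mg g0 g00 Xpos.
have mD : measurable (`]0, +oo[%classic : set K) by exact: measurable_itv.
have mf : measurable_fun setT (f : measurableTypeR K -> K).
  have h : measurable_fun setT f by exact: measurable_clock_kernel.
  exact: h.
have mt : measurable (`]0, t]%classic : set (measurableTypeR K)) by exact: measurable_itv.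
pose ind (s : measurableTypeR K) : \bar K := (\1_(`]0, t]%classic : set K) s : K)%:E.
have mi : measurable_fun setT ind.
  have h : measurable_fun setT (fun s : K => (\1_(`]0, t]%classic : set K) s : K)%:E).
    by apply/measurable_EFinP.
  exact: h.
have i0 s : (0 <= ind s)%E by rewrite lee_fin.
pose gD := g \_ (`]0, +oo[%classic : set K).
have mgD : measurable_fun setT gD.
  by apply/(measurable_restrictT _ _).1 => //; exact: measurable_funTS.
have gD0 x : (0 <= gD x)%E by rewrite /gD patchE; case: ifP.
have gDE x : 0 <= x -> gD x = g x.
  rewrite le_eqVlt => /orP[/eqP <-|x0].
    by rewrite /gD patchE g00; case: ifP.
  by rewrite /gD patchE mem_setE/= in_itv/= x0.
pose m1 : {measure set K -> \bar K} := pushforward_measure (density_measure lambda mi i0) mf.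
pose m2 : {measure set K -> \bar K} := mscale (NngNum (ltW t0)) (distribution P X).
transitivity (\int[m1]_x gD x)%E.
  rewrite /m1 ge0_integral_pushforward// preimage_setT ge0_integral_density//; last 2 first.
  - exact: (measurableT_comp mgD mf).
  - by move=> s; exact: gD0.
  rewrite [LHS]integral_mkcond; apply: eq_integral => s _.
  rewrite patchE /= /ind indicE gDE ?clock_kernel_ge0//.
  by case: ifP => _; rewrite ?mule1 ?mule0.
transitivity (\int[m2]_x gD x)%E.
  rewrite /gD -!integral_mkcond; apply: eq_measure_integral => A mA A0.
  rewrite /m1 /m2/= /pushforward/= /density_measure /mscale/= -clock_kernel_law//.
  have := mf measurableT A mA; rewrite setTI => mfA.
  by rewrite integral_indic.
rewrite ge0_integral_mscale//; congr (_ * _)%E.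
rewrite ge0_integral_distribution//; apply: eq_integral => w _ /=.
by rewrite gDE// ltW.
Qed.

End quantile_theory.

(** * Laplace transforms of sums of independent variables *)

Section independent_product.
Context (K : realType) (d : measure_display) (T : measurableType d)
  (P : probability T K) (n : nat) (X : nat -> T -> K).
Hypothesis mX : forall i, measurable_fun setT (X i).
Hypothesis X_indep : forall B : nat -> set K, (forall i, measurable (B i)) ->
  P (\bigcap_(i < n) (X i @^-1` B i)) = (\prod_(i < n) P (X i @^-1` B i))%E.

Let mprod (g : nat -> K -> K) (Q : pred 'I_n) : (forall i, measurable_fun setT (g i)) ->
  measurable_fun setT (fun w => \prod_(i < n | Q i) g i (X i w)).
Proof.
move=> mg; rewrite (_ : (fun w => _) = (fun w => \prod_(i <- enum 'I_n | Q i) g i (X i w))).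
  elim: (enum 'I_n) => [|i s IH].
    by under eq_fun do rewrite big_nil; exact: measurable_cst.
  under eq_fun do rewrite big_cons; case: (Q i) => //.
  by apply: measurable_funM => //; exact: measurableT_comp.
by apply/funext => w; rewrite big_enum_cond.
Qed.

Let integral_ind (A : set T) : measurable A -> (\int[P]_w (\1_A w)%:E = P A)%E.
Proof. by move=> mA; rewrite integral_indic// setIT. Qed.

(** One factor at a time: once [g k] may be replaced by any indicator, the
   measure with density the product of the other factors, pushed forward by
   [X k], is a multiple of the law of [X k]. *)
Let independent_prod_step k (g : nat -> K -> K) :
  (forall i, measurable_fun setT (g i)) -> (forall i x, 0 <= g i x <= 1) ->
  (forall i, (k <= i)%N -> exists2 B : set K, measurable B & g i = \1_B) ->
  (\int[P]_w (\prod_(i < n) g i (X i w))%:E = \prod_(i < n) \int[P]_w (g i (X i w))%:E)%E.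
Proof.
elim: k g => [|k IH] g mg g01 gB.
  have ex i : exists B : set K, measurable B /\ g i = \1_B.
    by have [B mB gE] := gB i (leq0n i); exists B.
  have [B hB] := boolp.choice ex.
  have mXB i : measurable (X i @^-1` B i).
    by rewrite -[X in measurable X]setTI; apply: mX => //; exact: (hB i).1.
  transitivity (P (\bigcap_(i < n) (X i @^-1` B i))).
    rewrite -integral_ind; last exact: fin_bigcap_measurable.
    apply: eq_integral => w _; congr EFin; rewrite indicE.
    under eq_bigr do rewrite (hB _).2 indicE.
    have [wB|wB] := boolP (w \in \bigcap_(i < n) (X i @^-1` B i)).
      rewrite big1// => i _; rewrite mem_set//.
      by move/set_mem : wB; apply; exact: ltn_ord.
    have [i iB] : exists i : 'I_n, X i w \notin B i.
      apply: contrapT => /forallNP nB; move/negP : wB; apply; apply/mem_set => i ni.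
      by have /negP/negPn/set_mem := nB (Ordinal ni).
    by rewrite (bigD1 i)//= (negbTE iB) mul0r.
  rewrite X_indep//; last by move=> i; exact: (hB i).1.
  apply: eq_bigr => i _; rewrite (hB i).2.
  by rewrite -integral_ind.
have [kn|nk] := ltnP k n; last first.
  rewrite (_ : (fun w => _) = (fun w => (\prod_(i < n)
      (if (i < n)%N then g i else \1_setT) (X i w))%:E)); last first.
    by apply/funext => w; congr EFin; apply: eq_bigr => i _; rewrite ltn_ord.
  rewrite (IH (fun i => if (i < n)%N then g i else \1_setT)).
  - by apply: eq_bigr => i _; rewrite ltn_ord.
  - by move=> i; case: ifP.
  - by move=> i x; case: ifP => // _; rewrite indicT /= ler01 lexx.
  - move=> i ki; rewrite ltnNge (leq_trans nk ki)/=.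
    by exists setT.
pose ko := Ordinal kn.
pose h w := \prod_(i < n | i != ko) g i (X i w).
have h01 w : 0 <= h w <= 1.
  apply/andP; split; first by apply: prodr_ge0 => i _; have /andP[] := g01 i (X i w).
  by apply: prodr_ile1 => i _; exact: g01.
have mh : measurable_fun setT h by exact: mprod.
have mhE : measurable_fun setT (EFin \o h) by exact/measurable_EFinP.
pose c : \bar K := (\prod_(i < n | i != ko) \int[P]_w (g i (X i w))%:E)%E.
have [c0 c1] : (0 <= c)%E /\ (c <= 1)%E.
  rewrite /c; elim/big_ind : _ => [|x y [x0 x1] [y0 y1]|i _]; first by rewrite lee01 lexx.
    by rewrite mule_ge0// -(mul1e 1%E); split => //; exact: lee_pmul.
  split; first by apply: integral_ge0 => w _; rewrite lee_fin; have /andP[] := g01 i (X i w).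
  rewrite -[leRHS](probability_setT P) -[leRHS]mul1e -integral_cst//.
  apply: ge0_le_integral => //.
  - by move=> w _; rewrite lee_fin; have /andP[] := g01 i (X i w).
  - by apply/measurable_EFinP; exact: measurableT_comp.
  - by move=> w _; rewrite lee_fin; have /andP[] := g01 i (X i w).
have cfin : c \is a fin_num by rewrite ge0_fin_numE// (le_lt_trans c1)// ltry.
have fc0 : 0 <= fine c by exact: fine_ge0.
pose nu : {measure set K -> \bar K} := mscale (NngNum fc0) (pushforward_measure P (mX k)).
have hnu B : measurable B -> (\int[P]_(w in X k @^-1` B) (h w)%:E = nu B)%E.
  move=> mB.
  pose g' i := if i == k then \1_B else g i : K -> K.
  have g'E (i : 'I_n) : i != ko -> g' i = g i.
    by move=> ik; rewrite /g' ifF//; apply: contraNF ik => /eqP ik; apply/eqP/val_inj.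
  have g'k : g' k = \1_B by rewrite /g' eqxx.
  have mXB : measurable (X k @^-1` B).
    by rewrite -[X in measurable X]setTI; exact: mX.
  have : (\int[P]_w (\prod_(i < n) g' i (X i w))%:E =
      \prod_(i < n) \int[P]_w (g' i (X i w))%:E)%E.
    apply: IH => [i|i x|i].
    - by rewrite /g'; case: ifP.
    - by rewrite /g'; case: ifP => // _; rewrite indicE; case: (_ \in _); rewrite /= ?ler01 ?lexx.
    - rewrite /g' leq_eqVlt => /orP[/eqP <-|ki]; first by rewrite eqxx; exists B.
      by rewrite gtn_eqF//; exact: gB.
  rewrite [RHS](bigD1 ko)//= g'k [X in (_ * X)%E](_ : _ = c); last first.
    by apply: eq_bigr => i ik; rewrite g'E.
  rewrite [X in (X * _)%E](_ : _ = P (X k @^-1` B)); last first.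
    by rewrite -integral_ind.
  rewrite /nu/= /mscale/= /pushforward/= fineK// muleC => <-.
  rewrite [LHS]integral_mkcond; apply: eq_integral => w _.
  rewrite (bigD1 ko)//= g'k patchE indicE.
  under eq_bigr => i ik do rewrite g'E//.
  have -> : (w \in X k @^-1` B) = (X k w \in B) by apply/idP/idP => /set_mem/mem_set.
  by case: ifP => _; rewrite ?mul1r ?mul0r.
have g0 x : (0 <= (g k x)%:E)%E by rewrite lee_fin; have /andP[] := g01 k x.
have h0 w : (0 <= (EFin \o h) w)%E by rewrite lee_fin; have /andP[] := h01 w.
have mgk : measurable_fun setT (EFin \o g k) by exact/measurable_EFinP.
have e := ge0_integral_comp_density (mX k) mhE h0 hnu mgk g0.
transitivity (\int[P]_w ((EFin \o g k) (X k w) * (EFin \o h) w))%E.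
  by apply: eq_integral => w _; rewrite (bigD1 ko)//= EFinM.
rewrite -e [RHS](bigD1 ko)//= -/c /nu ge0_integral_mscale//= fineK// muleC.
by rewrite ge0_integral_pushforward.
Qed.

(** Independence is given on events, that is for indicators, and is extended to
   one function after the other. *)
Lemma independent_prod (g : nat -> K -> K) :
  (forall i, measurable_fun setT (g i)) -> (forall i x, 0 <= g i x <= 1) ->
  (\int[P]_w (\prod_(i < n) g i (X i w))%:E = \prod_(i < n) \int[P]_w (g i (X i w))%:E)%E.
Proof.
move=> mg g01.
transitivity (\int[P]_w (\prod_(i < n) (if (i < n)%N then g i else \1_setT) (X i w))%:E)%E.
  by apply: eq_integral => w _; congr EFin; apply: eq_bigr => i _; rewrite ltn_ord.
rewrite (@independent_prod_step n (fun i => if (i < n)%N then g i else \1_setT)).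
- by apply: eq_bigr => i _; rewrite ltn_ord.
- by move=> i; case: ifP.
- by move=> i x; case: ifP => // _; rewrite indicT /= ler01 lexx.
- by move=> i ni; rewrite ltnNge ni/=; exists setT.
Qed.

End independent_product.

(** * Step approximation of a monotone integrand *)

Section step_approximation.
Context (K : realType) (t : K).
Hypothesis t0 : 0 < t.
Implicit Types (s : K) (n : nat).

Definition mesh n : K := t / n.+1%:R.

(** The right endpoint of the cell of the uniform partition that contains
   [s]. *)
Definition right_end n s : K := mesh n * (Num.ceil (s / mesh n))%:~R.

Lemma mesh_gt0 n : 0 < mesh n.
Proof. by rewrite divr_gt0. Qed.

Lemma mesh_end n : n.+1%:R * mesh n = t.
Proof. by rewrite mulrC divfK. Qed.

Lemma right_endE n i s : i%:R * mesh n < s <= i.+1%:R * mesh n ->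
  right_end n s = i.+1%:R * mesh n.
Proof.
move=> /andP[si si1]; rewrite /right_end.
have -> : Num.ceil (s / mesh n) = i.+1%:Z.
  apply: ceil_def.
  have -> : (i.+1%:Z - 1)%:~R = i%:R :> K by rewrite intS addrC addKr.
  by rewrite ltr_pdivlMr ?mesh_gt0// si ler_pdivrMr ?mesh_gt0.
by rewrite mulrC.
Qed.

Lemma right_end_ge n s : s <= right_end n s.
Proof.
by rewrite /right_end mulrC -ler_pdivrMr ?mesh_gt0// ceil_ge.
Qed.

Lemma right_end_le n s : s <= t -> right_end n s <= t.
Proof.
move=> st; rewrite /right_end -(mesh_end n) mulrC ler_pM2r ?mesh_gt0//.
rewrite -[leRHS]/((n.+1%:Z)%:~R) ler_int ceil_le_int.
by rewrite ler_pdivrMr ?mesh_gt0//= mesh_end.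
Qed.

Lemma right_end_lt n s : right_end n s < s + mesh n.
Proof.
have := ceilB1_lt (s / mesh n); rewrite ltr_pdivlMr ?mesh_gt0//.
by rewrite rmorphB/= mulrBl mul1r ltrBlDr /right_end mulrC.
Qed.

Lemma right_end_nondecreasing n : nondecreasing_fun (right_end n).
Proof.
move=> s s' ss'; rewrite /right_end ler_pM2l ?mesh_gt0// ler_int le_ceil//.
by rewrite ler_pM2r ?invr_gt0 ?mesh_gt0.
Qed.

Lemma right_end_cvg s : right_end n s @[n --> \oo] --> s.
Proof.
apply: (@squeeze_cvgr _ _ _ _ (fun=> s) (fun n => s + mesh n)).
- by apply: nearW => n; rewrite right_end_ge ltW// right_end_lt.
- exact: cvg_cst.
- rewrite -[X in _ --> X]addr0; apply: cvgD; first exact: cvg_cst.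
  by rewrite -[X in _ --> X](mulr0 t); apply: cvgMl_tmp; exact: cvg_harmonic.
Qed.

(** On each cell the integrand is constant, for an arbitrary measure: the same
   formula serves the random Stieltjes measure and Lebesgue measure. *)
Lemma integral_right_end (mu : {measure set (measurableTypeR K) -> \bar K})
    (h : K -> \bar K) n :
  measurable_fun setT h -> (forall x, (0 <= h x)%E) ->
  (\int[mu]_(s in `]0%R, t]) h (right_end n s) =
   \sum_(i < n.+1) h (i.+1%:R * mesh n)%R *
     mu `](i%:R * mesh n)%R, (i.+1%:R * mesh n)%R]%classic)%E.
Proof.
move=> mh h0; have m0 := mesh_gt0 n.
have mhr : measurable_fun setT (fun s : measurableTypeR K => h (right_end n s)).
  have H : measurable_fun setT (fun s : K => h (right_end n s)).
    apply: (measurableT_comp mh); apply: nondecreasing_measurable => //.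
    exact: right_end_nondecreasing.
  exact: H.
suff : forall j, (\int[mu]_(s in `]0%R, (j%:R * mesh n)%R]) h (right_end n s) =
    \sum_(i < j) h (i.+1%:R * mesh n)%R *
      mu `](i%:R * mesh n)%R, (i.+1%:R * mesh n)%R]%classic)%E.
  by move=> /(_ n.+1); rewrite mesh_end.
elim=> [|j IH].
  by rewrite big_ord0 mul0r set_itvoc0 integral_set0.
have jj : j%:R * mesh n <= j.+1%:R * mesh n by rewrite ler_pM2r// ler_nat.
have j0 : 0 <= j%:R * mesh n by rewrite mulr_ge0// ltW.
have -> : `]0, (j.+1%:R * mesh n)]%classic =
    `]0, j%:R * mesh n] `|` `]j%:R * mesh n, j.+1%:R * mesh n] :> set K.
  by rewrite -itv_bndbnd_setU.
have mi a c : measurable (`]a, c]%classic : set (measurableTypeR K)).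
  by have H : measurable (`]a, c]%classic : set K) by []; exact: H.
rewrite ge0_integral_setU//.
- rewrite big_ord_recr/= IH; congr (_ + _)%E.
  rewrite (eq_integral (cst (h (j.+1%:R * mesh n)%R))); last first.
    by move=> s; rewrite inE/= in_itv/= => /right_endE ->.
  by rewrite integral_cst.
- exact: measurable_funTS.
- apply/disj_setPS => s [/=]; rewrite !in_itv/= => /andP[_ sj] /andP[js _].
  by move: (lt_le_trans js sj); rewrite ltxx.
Qed.

End step_approximation.

(** * The Laplace transform of the clock *)

Section increments.
Context (K : realType) (d : measure_display) (T : measurableType d)
  (P : probability T K) (L : subordinator P) (t : K).
Hypothesis t0 : 0 < t.
Local Notation psi := (laplace_exponent_of (levy L)).

Let incr n i w := L (i.+1%:R * mesh t n) w - L (i%:R * mesh t n) w.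

Let node_ge0 n i : 0 <= i%:R * mesh t n.
Proof. by rewrite mulr_ge0// ltW// mesh_gt0. Qed.

Let node_le n i : i%:R * mesh t n <= i.+1%:R * mesh t n.
Proof. by rewrite ler_pM2r ?mesh_gt0// ler_nat. Qed.

Let incr_ge0 n i w : 0 <= incr n i w.
Proof. by rewrite subr_ge0; exact: sub_increasing. Qed.

Let mincr n i : measurable_fun setT (incr n i).
Proof. exact: measurable_funB. Qed.

Let mexp (c : K) : measurable_fun setT (fun x : K => (expR (- (c * Num.max 0 x)))%:E).
Proof.
apply/measurable_EFinP; apply: measurableT_comp => //; apply: measurableT_comp => //.
by apply: measurable_funM => //; exact: measurable_maxr.
Qed.

(** The truncation changes nothing on an increment, and bounds the exponential by 1
   on the whole line. *)
Let laplace_incr n i (c : K) : 0 <= c ->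
  (\int[P]_w (expR (- (c * Num.max 0 (incr n i w))))%:E =
   (expR (- (mesh t n * psi c)))%:E)%E.
Proof.
rewrite le_eqVlt => /orP[/eqP <-|c0].
  rewrite laplace_exponent_of0 ?mulr0; last exact: levy_integrable.
  under eq_integral do rewrite mul0r.
  by rewrite oppr0 expR0 integral_cst// mul1e; exact: probability_setT.
have st := @sub_stationary _ _ _ _ L (i%:R * mesh t n) (mesh t n) (node_ge0 n i)
  (ltW (mesh_gt0 t0 n)).
have e : i%:R * mesh t n + mesh t n = i.+1%:R * mesh t n by rewrite -natr1 mulrDl mul1r.
rewrite e in st.
rewrite (eq_law_integral st (mexp c))//.
rewrite -(@sub_laplace _ _ _ _ L _ _ (ltW (mesh_gt0 t0 n)) c0) unlock.
apply: eq_integral => w _; rewrite max_r//.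
by rewrite -[leLHS](sub_start0 L w); apply: sub_increasing => //; rewrite ltW// mesh_gt0.
Qed.

Lemma laplace_increments n (c : nat -> K) : (forall i, 0 <= c i) ->
  (\int[P]_w (expR (- \sum_(i < n.+1) c i *
     (L (i.+1%:R * mesh t n) w - L (i%:R * mesh t n) w)))%:E =
   (expR (- \sum_(i < n.+1) mesh t n * psi (c i)))%:E)%E.
Proof.
move=> c0.
transitivity (\int[P]_w (\prod_(i < n.+1) expR (- (c i * Num.max 0 (incr n i w))))%:E)%E.
  apply: eq_integral => w _; rewrite -sumrN expR_sum; congr EFin.
  by apply: eq_bigr => i _; rewrite max_r.
rewrite (@independent_prod _ _ _ P n.+1 (incr n) (mincr n) _
  (fun i x => expR (- (c i * Num.max 0 x)))).
- under eq_bigr do rewrite laplace_incr//.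
  by rewrite prodEFin -expR_sum sumrN.
- move=> B mB.
  exact: (@sub_independent _ _ _ _ L n.+1 (fun i => i%:R * mesh t n) B
    (node_ge0 n 0%N) (node_le n) mB).
- by move=> i; apply/measurable_EFinP; exact: mexp.
- move=> i x; rewrite expR_ge0/= -expR0 ler_expR oppr_le0 mulr_ge0//.
  by rewrite le_max lexx.
Qed.

End increments.

Section clock.
Context (K : realType) (d1 : measure_display) (T1 : measurableType d1)
  (P1 : probability T1 K) (d2 : measure_display) (T2 : measurableType d2)
  (P2 : probability T2 K) (X : {RV P1 >-> K}) (L : subordinator P2) (b t : K).
Hypothesis b0 : 0 <= b.
Hypothesis cdf_b : cdf X b = 1%E.
Hypothesis X_pos : forall w, 0 < X w.
Hypothesis t0 : 0 < t.
Local Notation lambda := (@lebesgue_measure K).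
Local Notation psi := (laplace_exponent_of (levy L)).
Local Notation f := (clock_kernel X t).
Local Notation mu w := (lebesgue_stieltjes_measure (sub_path L w)).
Local Notation r := (right_end t).

Let mu_itv w (a c : K) : 0 <= a -> a <= c -> mu w `]a, c]%classic = (L c w - L a w)%:E.
Proof.
move=> a0 ac; rewrite /lebesgue_stieltjes_measure /measure_extension/=.
rewrite measurable_mu_extE/=; last exact: is_ocitv.
by rewrite wlength_itv_bnd// /sub_path !max_r// (le_trans a0).
Qed.

Let lambda_itv (a c : K) : a <= c -> lambda `]a, c]%classic = (c - a)%:E.
Proof.
rewrite lebesgue_measure_itv/= lte_fin le_eqVlt => /orP[/eqP ->|->//].
by rewrite ltxx subrr.
Qed.

Let mitv (a c : K) : measurable (`]a, c]%classic : set (measurableTypeR K)).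
Proof. by have H : measurable (`]a, c]%classic : set K) by []; exact: H. Qed.

Let f_cvg s : 0 < s -> s <= t -> f (r n s) @[n --> \oo] --> f s.
Proof.
move=> s0 st; apply: (clock_kernel_right_continuous b0 cdf_b t0 (ltW s0) st).
  by move=> n; rewrite right_end_ge// right_end_le.
exact: right_end_cvg.
Qed.

Let f_ge0 := clock_kernel_ge0 b0 cdf_b t0.
Let f_le := clock_kernel_le b0 cdf_b t0.

Let mf : measurable_fun setT f.
Proof. exact: (measurable_clock_kernel b0 cdf_b t0). Qed.

Let mfr n : measurable_fun setT (f \o r n).
Proof.
apply: nonincreasing_measurable => // s s' ss' /=.
by apply: (clock_kernel_nonincreasing b0 cdf_b t0); exact: right_end_nondecreasing.
Qed.

Let S n w := \sum_(i < n.+1) f (i.+1%:R * mesh t n) *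
  (L (i.+1%:R * mesh t n) w - L (i%:R * mesh t n) w).

Lemma quantile_clockE w :
  quantile_clock X L t w = (\int[mu w]_(s in `]0%R, t]) (f s)%:E)%E.
Proof.
apply: eq_integral => s; rewrite inE/= in_itv/= => /andP[s0 st].
by rewrite /clock_kernel (max_r (ltW s0)).
Qed.

(** Both sides of the Laplace transform are limits of such step integrals: once
   against the random Stieltjes measure, once against Lebesgue measure. *)
Let step_cvg (m : {measure set (measurableTypeR K) -> \bar K}) (g : K -> K) (c : K) :
  (m `]0%R, t]%classic < +oo)%E -> continuous g ->
  (forall x, 0 <= x -> x <= b -> 0 <= g x <= c) ->
  (\int[m]_(s in `]0%R, t]) (g (f (r n s)))%:E)%E @[n --> \oo] -->
  (\int[m]_(s in `]0%R, t]) (g (f s))%:E)%E.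
Proof.
move=> mfin cg g0c.
have mg : measurable_fun setT g by exact: continuous_measurable_fun.
have gf s : 0 <= g (f s) <= c by rewrite g0c.
have mgf (h : K -> K) : measurable_fun setT h ->
    measurable_fun (`]0, t]%classic : set (measurableTypeR K)) (fun s => (g (h s))%:E).
  move=> mh; have H : measurable_fun (`]0, t]%classic : set K) (fun s => (g (h s))%:E).
    by apply: measurable_funTS; apply/measurable_EFinP; exact: measurableT_comp.
  exact: H.
have [|||||_ _ //] := @dominated_convergence _ _ _ m `]0, t]%classic (mitv 0 t)
  (fun n s => (g (f (r n s)))%:E) (fun s => (g (f s))%:E) (cst c%:E).
- by move=> n; apply: (mgf (f \o r n)); exact: mfr.
- exact: (mgf f).
- apply/aeW => s /=; rewrite in_itv/= => /andP[s0 st].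
  apply: cvg_EFin; first exact: nearW.
  by apply: continuous_cvg; [exact: cg|exact: f_cvg].
- apply/integrableP; split; first exact: measurable_cst.
  have /andP[g0 gc] := gf 0.
  rewrite integral_cst//=.
  by rewrite lte_mul_pinfty// lee_fin.
- apply/aeW => s n _; have /andP[g0 gc] := gf (r n s).
  by rewrite gee0_abs lee_fin.
Qed.

Let S_cvg w : (S n w)%:E @[n --> \oo] --> quantile_clock X L t w.
Proof.
rewrite quantile_clockE.
have SE n : (S n w)%:E = (\int[mu w]_(s in `]0%R, t]) (`|f (r n s)|)%:E)%E.
  rewrite (@integral_right_end K t t0 (mu w) (fun s => (`|f s|)%:E))//; last first.
    by apply/measurable_EFinP; exact: measurableT_comp.
  rewrite /S -sumEFin; apply: eq_bigr => i _.
  rewrite ger0_norm// EFinM; congr (_ * _)%E; apply/esym/mu_itv.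
    by rewrite mulr_ge0// ltW// mesh_gt0.
  by rewrite ler_pM2r ?mesh_gt0// ler_nat.
have mut : (mu w `]0%R, t]%classic < +oo)%E by rewrite [ltLHS](mu_itv w (lexx 0) (ltW t0)) ltry.
under eq_fun do rewrite SE.
rewrite (_ : integral _ _ _ = (\int[mu w]_(s in `]0%R, t]) (`|f s|)%:E)%E); last first.
  by apply: eq_integral => s _; rewrite ger0_norm.
apply: (@step_cvg (mu w) (fun x => `|x|) b).
- exact: mut.
- exact: norm_continuous.
- by move=> x x0 xb; rewrite ger0_norm// x0.
Qed.

Let S_ge0 n w : 0 <= S n w.
Proof.
apply: sumr_ge0 => i _; rewrite mulr_ge0// subr_ge0.
apply: sub_increasing; first by rewrite mulr_ge0// ltW// mesh_gt0.
by rewrite ler_pM2r ?mesh_gt0// ler_nat.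
Qed.

Let mS n : measurable_fun setT (S n).
Proof.
apply: measurable_sum => i; apply: measurable_funM => //.
exact: measurable_funB.
Qed.

Lemma measurable_quantile_clock : measurable_fun setT (quantile_clock X L t).
Proof.
apply: (@emeasurable_fun_cvg _ _ _ _ (fun n w => (S n w)%:E)) => [n|w _].
  exact/measurable_EFinP.
exact: S_cvg.
Qed.

Lemma quantile_clock_ge0 w : (0 <= quantile_clock X L t w)%E.
Proof. by rewrite quantile_clockE; apply: integral_ge0 => s _; rewrite lee_fin. Qed.

Lemma quantile_clock_fin w : quantile_clock X L t w \is a fin_num.
Proof.
rewrite ge0_fin_numE ?quantile_clock_ge0// quantile_clockE.
apply: (@le_lt_trans _ _ (\int[mu w]_(s in `]0%R, t]) (cst b%:E s))%E).
  apply: ge0_le_integral => //.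
  - by move=> s _; rewrite lee_fin.
  - have H : measurable_fun (`]0, t]%classic : set K) (fun s => (f s)%:E).
      by apply: measurable_funTS; apply/measurable_EFinP.
    exact: H.
  - by move=> s _; rewrite lee_fin.
rewrite integral_cst//.
by rewrite [X in (_ * X)%E](mu_itv w (lexx 0) (ltW t0)) -EFinM ltry.
Qed.

(** Riemann sums of [g] along the clock kernel average [g] against the law of
   [X], since the kernel carries Lebesgue measure on [0, t] to [t] times it. *)
Let riemann_cvg (g : K -> K) (c : K) : continuous g -> (forall x, 0 <= g x) ->
  (forall x, 0 <= x -> x <= b -> g x <= c) -> g 0 = 0 ->
  \sum_(i < n.+1) mesh t n * g (f (i.+1%:R * mesh t n)) @[n --> \oo] -->
  t * fine (\int[P1]_v (g (X v))%:E)%E.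
Proof.
move=> cg g0 gc g00.
have g0c x : 0 <= x -> x <= b -> 0 <= g x <= c by move=> x0 xb; rewrite g0 gc.
have mEg : measurable_fun setT (EFin \o g).
  by apply/measurable_EFinP; exact: continuous_measurable_fun.
have Eg0 x : (0 <= (EFin \o g) x)%E by rewrite lee_fin.
have mEgf : measurable_fun setT (fun s => (g (f s))%:E) by exact: (measurableT_comp mEg mf).
have GE n : (\sum_(i < n.+1) mesh t n * g (f (i.+1%:R * mesh t n)))%:E =
    (\int[lambda]_(s in `]0%R, t]) (g (f (r n s)))%:E)%E.
  rewrite [RHS](@integral_right_end K t t0 lambda (fun s => (g (f s))%:E) n mEgf
    (fun s => Eg0 (f s))).
  rewrite -sumEFin; apply: eq_bigr => i _.
  have cell : i%:R * mesh t n <= i.+1%:R * mesh t n.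
    by rewrite ler_pM2r ?mesh_gt0// ler_nat.
  by rewrite [X in (_ * X)%E](lambda_itv cell) -mulrBl -natrB// subSnn mul1r -EFinM mulrC.
have lamfin : (lambda `]0%R, t]%classic < +oo)%E.
  by rewrite [ltLHS](lambda_itv (ltW t0)) ltry.
have Gcv := @step_cvg lambda g c lamfin cg g0c.
have limE := integral_clock_kernel b0 cdf_b t0 mEg Eg0 (congr1 EFin g00) X_pos.
have Efin : (\int[P1]_v (g (X v))%:E)%E \is a fin_num.
  have : (t%:E * \int[P1]_v (g (X v))%:E < +oo)%E.
    rewrite -limE.
    apply: (@le_lt_trans _ _ (\int[lambda]_(s in `]0%R, t]) (cst c%:E s))%E).
      apply: ge0_le_integral => //.
      - have H : measurable_fun (`]0, t]%classic : set K) (fun s => (EFin \o g) (f s)).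
          by apply: measurable_funTS; exact: (measurableT_comp mEg).
        exact: H.
      - by move=> s _; rewrite lee_fin; have /andP[] := g0c _ (f_ge0 s) (f_le s).
    rewrite integral_cst//.
    have c0 : 0 <= c := le_trans (g0 0) (gc 0 (lexx 0) b0).
    by rewrite lte_mul_pinfty// lee_fin.
  have E0 : (0 <= \int[P1]_v (g (X v))%:E)%E.
    by apply: integral_ge0 => v _; rewrite lee_fin.
  move: E0; case: (integral _ _ _) => [//|_|//].
  by rewrite gt0_muley// lte_fin.
apply: (@fine_cvg _ _ _ _ (fun n => (\sum_(i < n.+1) mesh t n * g (f (i.+1%:R * mesh t n)))%:E)).
rewrite EFinM fineK// -limE; under eq_fun do rewrite GE.
exact: Gcv.
Qed.

(** The clock is the limit of the step sums [S n], whose Laplace transform is the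
   exponential of a Riemann sum of [psi] along the kernel.  Both sides converge:
   the left one because exponentials are at most 1, the right one by
   [riemann_cvg]. *)
Lemma quantile_clock_laplace (w : K) : 0 < w ->
  (\int[P2]_v (expR (- (w * fine (quantile_clock X L t v))))%:E =
   (expR (- (t * fine (\int[P1]_v (psi (w * X v))%:E))))%:E)%E.
Proof.
move=> w0.
have Lint := levy_integrable L.
have wf0 s : 0 <= w * f s := mulr_ge0 (ltW w0) (f_ge0 s).
pose G n := \sum_(i < n.+1) mesh t n * psi (w * f (i.+1%:R * mesh t n)).
have GcvR : G n @[n --> \oo] --> t * fine (\int[P1]_v (psi (w * X v))%:E)%E.
  have EX : (\int[P1]_v (psi `|w * X v|)%:E = \int[P1]_v (psi (w * X v))%:E)%E.
    by apply: eq_integral => v _; rewrite gtr0_norm// mulr_gt0.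
  have GE : G = fun n => \sum_(i < n.+1) mesh t n * psi `|w * f (i.+1%:R * mesh t n)|.
    by apply/funext => n; apply: eq_bigr => i _; rewrite (ger0_norm (wf0 _)).
  rewrite GE -EX; apply: (@riemann_cvg (fun x => psi `|w * x|) (psi (w * b))).
  - move=> x; apply: (@continuous_comp _ _ _ ( *%R w) (fun x => psi `|x|)).
      exact: mulrl_continuous.
    exact: (continuous_laplace_exponent_of Lint).
  - by move=> x; exact: (laplace_exponent_of_ge0 Lint (normr_ge0 _)).
  - move=> x x0 xb; apply: (laplace_exponent_of_le Lint (normr_ge0 _)).
    rewrite (ger0_norm (mulr_ge0 (ltW w0) x0)) (ler_pM2l w0); exact: xb.
  - transitivity (psi 0); last exact: (laplace_exponent_of0 Lint).
    by congr (laplace_exponent_of _ _); rewrite mulr0 normr0.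
have SR v : S n v @[n --> \oo] --> fine (quantile_clock X L t v).
  have := @S_cvg v; rewrite -(fineK (quantile_clock_fin v)) => h.
  exact: (@fine_cvg _ _ _ _ (fun n => (S n v)%:E) _ h).
have LE n : (\int[P2]_v (expR (- (w * S n v)))%:E = (expR (- G n))%:E)%E.
  rewrite /G -(laplace_increments L t0 n (fun i => wf0 (i.+1%:R * mesh t n))).
  apply: eq_integral => v _; rewrite /S mulr_sumr; congr (expR (- _))%:E.
  by apply: eq_bigr => i _; rewrite mulrA.
have lim1 : (\int[P2]_v (expR (- (w * S n v)))%:E)%E @[n --> \oo] -->
    (\int[P2]_v (expR (- (w * fine (quantile_clock X L t v))))%:E)%E.
  have [|||||_ _ //] := @dominated_convergence _ _ _ P2 setT measurableT
    (fun n v => (expR (- (w * S n v)))%:E)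
    (fun v => (expR (- (w * fine (quantile_clock X L t v))))%:E) (cst 1%E).
  - move=> n; apply/measurable_EFinP; apply: measurableT_comp => //.
    by apply: measurableT_comp => //; exact: measurable_funM.
  - apply/measurable_EFinP; apply: measurableT_comp => //.
    apply: measurableT_comp => //; apply: measurable_funM => //.
    exact: (measurableT_comp _ measurable_quantile_clock).
  - apply/aeW => v _; apply: cvg_EFin; first exact: nearW.
    apply: continuous_cvg; first exact: continuous_expR.
    by apply: cvgN; apply: cvgMl_tmp; exact: SR.
  - exact: finite_measure_integrable_cst.
  - apply/aeW => v n _; rewrite gee0_abs ?lee_fin ?expR_ge0//.
    by rewrite -expR0 ler_expR oppr_le0 mulr_ge0// ltW.
have lim2 : (\int[P2]_v (expR (- (w * S n v)))%:E)%E @[n --> \oo] -->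
    (expR (- (t * fine (\int[P1]_v (psi (w * X v))%:E))))%:E%E.
  rewrite (_ : (fun n => _) = (fun n => (expR (- G n))%:E)); last exact/funext.
  apply: cvg_EFin; first exact: nearW.
  apply: continuous_cvg; first exact: continuous_expR.
  exact: cvgN.
exact: (cvg_unique (@ereal_hausdorff K) lim1 lim2).
Qed.

End clock.

(** * Laws on the half-line are determined by their Laplace transform *)

Section laplace_law.
Context (K : realType) (d1 : measure_display) (T1 : measurableType d1)
  (P1 : probability T1 K) (d2 : measure_display) (T2 : measurableType d2)
  (P2 : probability T2 K) (X1 : T1 -> K) (X2 : T2 -> K).
Hypothesis mX1 : measurable_fun setT X1.
Hypothesis mX2 : measurable_fun setT X2.
Hypothesis X1_ge0 : forall w, 0 <= X1 w.
Hypothesis X2_ge0 : forall w, 0 <= X2 w.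
Hypothesis laplace_eq : forall w : K, 0 < w ->
  (\int[P1]_v (expR (- (w * X1 v)))%:E = \int[P2]_v (expR (- (w * X2 v)))%:E)%E.
Local Notation D := (`]0, +oo[%classic : set K).

Let mD : measurable (D : set K).
Proof. exact: measurable_itv. Qed.

(** One minus the Laplace transform is the Laplace exponent of the law, which does
   not see the atom at 0. *)
Let onem_laplace (d : measure_display) (T : measurableType d) (P : probability T K)
    (X : T -> K) (mX : measurable_fun setT X) (w : K) : (forall v, 0 <= X v) -> 0 < w ->
  (\int[pushforward_measure P mX]_(s in D) (1 - expR (- (w * s)))%:E =
   1 - \int[P]_v (expR (- (w * X v)))%:E)%E /\
  (\int[pushforward_measure P mX]_(s in D) (1 - expR (- (w * s)))%:E < +oo)%E.
Proof.
move=> X0 w0.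
have mE : measurable_fun setT (fun v => (expR (- (w * X v)))%:E).
  apply/measurable_EFinP; apply: measurableT_comp => //.
  by apply: measurableT_comp => //; exact: measurable_funM.
have m1E : measurable_fun setT (fun v => (1 - expR (- (w * X v)))%:E).
  apply/measurable_EFinP; apply: measurable_funB => //.
  exact/measurable_EFinP.
have e1 v : 0 <= 1 - expR (- (w * X v)) by rewrite onem_expR_ge0// ltW.
have -> : (\int[pushforward_measure P mX]_(s in D) (1 - expR (- (w * s)))%:E =
    \int[P]_v (1 - expR (- (w * X v)))%:E)%E.
  rewrite ge0_integral_pushforward//.
  - rewrite integral_mkcond; apply: eq_integral => v _; rewrite patchE /=.
    case: ifPn => //; rewrite notin_setE/= in_itv/= andbT => /negP.
    rewrite -leNgt => Xv; have -> : X v = 0 by apply/eqP; rewrite eq_le Xv X0.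
    by rewrite mulr0 oppr0 expR0 subrr.
  - by apply/measurable_EFinP; exact: measurable_onem_expR.
  - move=> s; rewrite inE/= in_itv/= andbT => s0.
    by rewrite lee_fin onem_expR_ge0// ltW.
have sum1 : (\int[P]_v (1 - expR (- (w * X v)))%:E + \int[P]_v (expR (- (w * X v)))%:E = 1)%E.
  rewrite -ge0_integralD//; last by move=> v _; rewrite lee_fin.
  under eq_integral do rewrite -EFinD subrK.
  by rewrite integral_cst// mul1e; exact: probability_setT.
have i0 : (0 <= \int[P]_v (1 - expR (- (w * X v)))%:E)%E.
  by apply: integral_ge0 => v _; rewrite lee_fin.
have j0 : (0 <= \int[P]_v (expR (- (w * X v)))%:E)%E.
  by apply: integral_ge0 => v _; rewrite lee_fin expR_ge0.
move: sum1 i0 j0; case: (integral _ _ _) => [x||]; case: (integral _ _ _) => [y||]//=.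
by rewrite -EFinD -EFinB => -[<-] _ _; rewrite addrK ltry.
Qed.

(** Uniqueness of exponents settles the open half-line, and the mass at 0 is what
   is left of 1. *)
Lemma laplace_law (A : set K) : measurable A -> P1 (X1 @^-1` A) = P2 (X2 @^-1` A).
Proof.
move=> mA.
pose m1 := pushforward_measure P1 mX1; pose m2 := pushforward_measure P2 mX2.
have eqD B : measurable B -> B `<=` D -> m1 B = m2 B.
  apply: laplace_exponent_unique => w w0.
    by rewrite (onem_laplace P1 mX1 X1_ge0 w0).1 (onem_laplace P2 mX2 X2_ge0 w0).1 laplace_eq.
  exact: (onem_laplace P1 mX1 X1_ge0 w0).2.
have off (d : measure_display) (T : measurableType d) (P : probability T K) (X : T -> K)
    (mX : measurable_fun setT X) : (forall v, 0 <= X v) ->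
    P (X @^-1` (A `\` D)) = if 0 \in A then (1 - P (X @^-1` D))%E else 0%E.
  move=> X0; have mXD : measurable (X @^-1` D).
    by rewrite -[Y in measurable Y]setTI; exact: mX.
  case: ifPn => A0.
    rewrite -probability_setC//; congr (P _); apply/seteqP; split => v /=; first by case.
    move=> nD; split=> //; suff -> : X v = 0 by exact: set_mem.
    apply/eqP; rewrite eq_le X0 andbT leNgt; apply/negP => v0.
    by apply: nD; rewrite /= in_itv/= v0.
  rewrite (_ : _ @^-1` _ = set0) ?measure0//; apply/seteqP; split=> // v /= [Av nD].
  move/negP : A0; apply; rewrite inE; suff <- : X v = 0 by [].
  apply/eqP; rewrite eq_le X0 andbT leNgt; apply/negP => v0.
  by apply: nD; rewrite /= in_itv/= v0.
rewrite -[LHS]/(m1 A) -[RHS]/(m2 A) (measureDI m1 mA mD) (measureDI m2 mA mD).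
congr (_ + _)%E; last by apply: eqD; [exact: measurableI|exact: subIsetr].
rewrite -[LHS]/(P1 (X1 @^-1` (A `\` D))) -[RHS]/(P2 (X2 @^-1` (A `\` D))) !off//.
by rewrite -[P1 _]/(m1 D) -[P2 _]/(m2 D) eqD.
Qed.

End laplace_law.

(** * The distributional identity *)

Section bounded_support.
Context (K : realType) (d : measure_display) (T : measurableType d)
  (P : probability T K) (R : {RV P >-> K}) (f : K -> K) (M : K).
Hypothesis R_density : has_density P R f.
Hypothesis f_support : forall x, M < `|x| -> f x = 0.

Lemma cdf_bounded_support (b : K) : 0 <= b -> M <= b -> cdf R b = 1%E.
Proof.
move=> b0 Mb; have [mR _ _ RE] := R_density.
have Rb : P (R @^-1` `]b, +oo[) = 0%E.
  rewrite RE//; apply: integral0_eq => x /=; rewrite in_itv/= andbT => bx.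
  by rewrite f_support// (le_lt_trans Mb)// (lt_le_trans bx)// ler_norm.
have mRb : measurable (R @^-1` `]b, +oo[) by rewrite -[Y in measurable Y]setTI; exact: mR.
rewrite /cdf /distribution/= /pushforward -setCitvr preimage_setC probability_setC//.
by rewrite Rb sube0.
Qed.

End bounded_support.

Section clock_law.
Context (K : realType) (delta : K) (d : measure_display) (T : measurableType d)
  (P : probability T K) (d1 : measure_display) (T1 : measurableType d1)
  (P1 : probability T1 K) (R Y U : {RV P >-> K}) (Z : subordinator P)
  (zeta : subordinator P1) (d2 : measure_display) (T2 : measurableType d2)
  (P2 : probability T2 K) (L : subordinator P2).
Hypothesis R_pos : forall w, 0 < R w.
Hypothesis Y_pos : forall w, 0 < Y w.
Hypothesis YR : independent_rv Y R.
Hypothesis RY_law : eq_law P P (fun w => R w * Y w) (fun w => U w `^ delta^-1).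
Hypothesis zetaE : forall omega : K, 0 < omega ->
  (laplace_exponent zeta omega)%:E =
  'E_P[fun w => laplace_exponent Z (omega * U w `^ delta^-1)]%E.
Hypothesis LE : forall omega : K, 0 < omega ->
  (laplace_exponent L omega)%:E =
  'E_P[fun w => laplace_exponent Z (omega * Y w)]%E.

(** Conditioning on [R], the exponent of [L] at [w R] is the mean of that of [Z] at
   [w R Y], and [R Y] has the law of [U^(1/delta)]. *)
Lemma mixed_exponent (w : K) : 0 < w ->
  (\int[P]_v (laplace_exponent L (w * R v))%:E = (laplace_exponent zeta w)%:E)%E.
Proof.
move=> w0; rewrite zetaE// unlock.
have mpsi := measurable_laplace_exponent_of (levy_integrable Z).
pose k (x : K) : \bar K := (laplace_exponent Z `|w * x|)%:E.
have mk : measurable_fun setT k.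
  apply/measurable_EFinP; apply: (measurableT_comp mpsi).
  exact: measurable_funM.
have k0 x : (0 <= k x)%E.
  by rewrite lee_fin; exact: (laplace_exponent_of_ge0 (levy_integrable Z) (normr_ge0 _)).
transitivity (\int[P]_v \int[P]_v' k (R v * Y v')%R)%E.
  apply: eq_integral => v _; rewrite LE ?mulr_gt0// unlock.
  apply: eq_integral => v' _; rewrite /k mulrA gtr0_norm//.
  by rewrite !mulr_gt0.
transitivity (\int[P]_v k (R v * Y v)%R)%E.
  have mk2 : measurable_fun setT (fun z : K * K => k (z.1 * z.2)).
    by apply: (measurableT_comp mk); exact: measurable_funM.
  apply/esym.
  exact: (independent_integral (independent_rvC YR) mk2 (fun z => k0 _)).
rewrite (eq_law_integral RY_law mk k0); apply: eq_integral => v _.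
by rewrite /k ger0_norm// mulr_ge0 ?powR_ge0// ltW.
Qed.

Variable b : K.
Hypothesis b0 : 0 <= b.
Hypothesis cdf_b : cdf R b = 1%E.

Lemma quantile_clock_law (t : K) : 0 <= t ->
  eq_law P2 P1 (quantile_clock R L t) (fun w => (zeta t w)%:E).
Proof.
have mzeta : measurable_fun setT (fun w => (zeta t w)%:E) by apply/measurable_EFinP.
(* At time 0 the kernel divides by 0, but it is integrated over an empty set. *)
rewrite le_eqVlt => /orP[/eqP t0|t0].
  have -> : quantile_clock R L t = cst 0%E.
    by apply/funext => w; rewrite /quantile_clock -t0 set_itvoc0 integral_set0.
  have -> : (fun w => (zeta t w)%:E) = cst 0%E.
    by apply/funext => w; rewrite -t0 sub_start0.
  split; [exact: measurable_cst|exact: measurable_cst|move=> A mA].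
  by rewrite !preimage_cst; case: ifP => _; rewrite ?measure0 ?probability_setT.
have mT := measurable_quantile_clock L b0 cdf_b t0.
have finT := quantile_clock_fin L b0 cdf_b t0.
split=> // A mA.
have mA' : measurable (EFin @^-1` A).
  by rewrite -[B in measurable B]setTI; exact: EFin_measurable.
have -> : quantile_clock R L t @^-1` A =
    (fine \o quantile_clock R L t) @^-1` (EFin @^-1` A).
  by apply/seteqP; split=> v /=; rewrite fineK.
rewrite -[RHS]/(P1 (zeta t @^-1` (EFin @^-1` A))).
apply: laplace_law => //.
- exact: (measurableT_comp _ mT).
- by move=> v /=; exact/fine_ge0/(quantile_clock_ge0 L b0 cdf_b t0).
- by move=> v; rewrite -(sub_start0 zeta v); apply: sub_increasing; rewrite // ltW.
- move=> w w0; rewrite (quantile_clock_laplace L b0 cdf_b R_pos t0 w0).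
  rewrite (mixed_exponent w0) /=.
  by have := sub_laplace zeta (ltW t0) w0; rewrite unlock => ->.
Qed.

End clock_law.

Theorem theorem4p1 (K : realType) (delta : K)
    (d : measure_display) (T : measurableType d) (P : probability T K)
    (d1 : measure_display) (T1 : measurableType d1) (P1 : probability T1 K)
    (R Y U : {RV P >-> K}) (Z : subordinator P) (zeta : subordinator P1)
    (hdelta : 0 < delta)
    (hR : clock_variable R)
    (hRdens : exists2 f : K -> K, has_density P R f &
                exists M : K, forall x, M < `|x| -> f x = 0)
    (hYpos : forall w, 0 < Y w)
    (hYbnd : exists M : K, forall w, Y w <= M)
    (hYR : independent_rv Y R)
    (hYZ : independent_of_process Y Z)
    (hU : forall A : set K, measurable A ->
            distribution P U A = uniform_prob (@ltr01 K) A)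
    (hRY : eq_law P P (fun w => R w * Y w) (fun w => U w `^ delta^-1))
    (hzeta : forall omega : K, 0 < omega ->
       (laplace_exponent zeta omega)%:E =
       'E_P[fun w => laplace_exponent Z (omega * U w `^ delta^-1)]%E) :
  [/\ has_density P (fun w => U w `^ delta^-1) (beta_density delta 1),
      forall c : K, 0 < c ->
        eq_law P P R (fun w => c * U w `^ delta^-1) ->
        {ae P, forall w, Y w = c^-1},
      is_BDLP delta zeta Z /\ in_class_U delta zeta,
      forall omega : K, 0 < omega ->
        derivable (laplace_exponent zeta) omega 1 /\
        laplace_exponent Z omega =
          laplace_exponent zeta omega +
          delta^-1 * omega * derive1 (laplace_exponent zeta) omega
    & forall (d2 : measure_display) (T2 : measurableType d2)
             (P2 : probability T2 K) (L : subordinator P2),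
        infinite_activity L ->
        let psiL_is_mixture := forall omega : K, 0 < omega ->
          (laplace_exponent L omega)%:E =
          'E_P[fun w => laplace_exponent Z (omega * Y w)]%E in
        [/\ forall rho : K -> K, levy_density Z (EFin \o rho) ->
              (psiL_is_mixture <->
               levy_density L
                 (fun x => 'E_P[fun w => (rho (x / Y w) * (Y w)^-1)%R]%E)),
            psiL_is_mixture <->
              (forall omega : K, 0 < omega ->
                 (laplace_exponent L omega)%:E =
                 ('E_P[fun w => laplace_exponent zeta (omega * Y w)] +
                  (delta^-1 * omega)%R%:E *
                  'E_P[fun w =>
                    (Y w * derive1 (laplace_exponent zeta) (omega * Y w))%R])%E)
          & psiL_is_mixture ->
            forall t : K, 0 <= t ->
              eq_law P2 P1 (quantile_clock R L t) (fun w => (zeta t w)%:E)]].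
Proof.
have mZ_int := levy_integrable Z.
have mzeta_int := levy_integrable zeta.
have mV := measurable_uniform_power U delta.
have bdlp : is_BDLP delta zeta Z.
  move=> w w0; rewrite hzeta// unlock.
  pose k (u : K) : \bar K := (laplace_exponent Z `|w * u `^ delta^-1|)%:E.
  have mk : measurable_fun setT k.
    apply/measurable_EFinP.
    apply: (measurableT_comp (measurable_laplace_exponent_of mZ_int)).
    by apply: measurable_funM => //; exact: measurable_powR.
  have k0 x : (0 <= k x)%E.
    by rewrite lee_fin; exact: (laplace_exponent_of_ge0 mZ_int (normr_ge0 _)).
  have kE (u : K) : k u = (laplace_exponent Z (w * u `^ delta^-1))%:E.
    by rewrite /k ger0_norm// mulr_ge0 ?powR_ge0// ltW.
  under eq_integral do rewrite -kE.
  rewrite (ge0_integral_uniform_rv hU mk k0).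
  by apply: eq_integral => u _; rewrite kE.
have zeta_le := power_mixture_le mZ_int hdelta bdlp.
have zeta_derive := power_mixture_derive mZ_int hdelta bdlp.
split.
- split=> //.
  + rewrite (_ : beta_density delta 1 = power_density delta).
      exact: measurable_power_density.
    by apply/funext => x; exact: (beta_density_power hU hdelta).
  + move=> x; rewrite (beta_density_power hU hdelta).
    exact: power_density_ge0.
  + move=> A mA; rewrite (uniform_power_law hU hdelta mA).
    by apply: eq_integral => x _; rewrite (beta_density_power hU hdelta).
- move=> c c0 R_law.
  exact: (scaled_uniform_power_cst hU hdelta c0 (clock_pos hR) hYpos hYR hRY R_law).
- by split=> //; exists d, T, P, Z.
- exact: zeta_derive.
- move=> d2 T2 P2 L _ mixture.
  have mL_int := levy_integrable L.
  split.
  + move=> rho [mrho rho_ge0 rhoE]; apply: (mixture_levy_density hYpos mZ_int mL_int) => //.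
    exact/measurable_EFinP.
  + have E := mixture_derivative hYpos mZ_int mzeta_int hdelta zeta_le
      (fun w w0 => (zeta_derive w w0).2).
    split=> H w w0; have Ew := E w w0.
      by rewrite (H w w0); exact: Ew.
    by rewrite (H w w0); apply/esym; exact: Ew.
  + move=> LE; have [f R_density [M f_support]] := hRdens.
    have b0 : 0 <= Num.max 0 M by rewrite le_max lexx.
    have Mb : M <= Num.max 0 M by rewrite le_max lexx orbT.
    have cdf_b := cdf_bounded_support R_density f_support b0 Mb.
    exact: (quantile_clock_law (clock_pos hR) hYpos hYR hRY hzeta LE b0 cdf_b).
Qed.
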